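(* Let $\mathbb{K}$ be a field (or, more generally, a commutative associative ring with unit). The graded $\mathbb{K}$-vector space $\mathcal{L}=\bigoplus_{n\ge 0}\mathcal{L}_n$ spanned by $S_n$-orbits of Lagrangian subspaces of $\mathbb{F}_2^{2n}$, with the multiplication $[L_1]\cdot[L_2]=[L_1\oplus L_2]$ and the comultiplication $\Delta([L])=\sum_{I\subset\{1,\dots,n\}}[L|_I]\otimes[L|_{\{1,\dots,n\}\setminus I}]$ for $L\subset \mathbb{F}_2^{2n}$, is a commutative, cocommutative, associative and coassociative bialgebra. Moreover, the canonical embedding $\mathcal{G}\hookrightarrow\mathcal{L}$, $\Gamma\mapsto[L(\Gamma)]$, of the bialgebra of graphs $\mathcal{G}$ is a homomorphism of bialgebras.
   Context: Let $\mathbb{F}_2^{2n}$ have basis $e_1,\dots,e_n,f_1,\dots,f_n$ and alternating form determined by $(e_i,f_j)=\delta_{ij}$, $(e_i,e_j)=(f_i,f_j)=0$. Let $LGr(n)$ be the finite set of all Lagrangian (maximal isotropic, i.e. $n$-dimensional isotropic) subspaces. The symmetric group $S_n$ acts on $\mathbb{F}_2^{2n}$ by simultaneous permutations of the $e_i$ and the $f_i$, hence on $LGr(n)$; $[L]$ denotes the orbit of $L$. $\mathcal{L}_n$ is the $\mathbb{K}$-vector space (free module) with basis the set of orbits $LGr(n)/S_n$; $\mathcal{L}_0=\mathbb{K}$. Multiplication: for $L_1\subset\mathbb{F}_2^{2n}$, $L_2\subset\mathbb{F}_2^{2m}$ Lagrangian, $L_1\oplus L_2\subset\mathbb{F}_2^{2n}\oplus\mathbb{F}_2^{2m}=\mathbb{F}_2^{2(n+m)}$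 is Lagrangian, and $[L_1]\cdot[L_2]=[L_1\oplus L_2]$, extended bilinearly. The unit is the class of $\{0\}\subset\mathbb{F}_2^0$. Restriction (symplectic reduction): put $\mathcal{N}=\{1,\dots,n\}$ and, for $I\subset\mathcal{N}$, $E_I=\langle e_i\mid i\in I\rangle$, $F_I=\langle f_i\mid i\in I\rangle$, $W_I=E_I\oplus F_{\mathcal{N}}$. Then $W_I^{\perp}=F_{\mathcal{N}\setminus I}\subset W_I$; let $\pi_I:W_I\to W_I/W_I^\perp=E_I\oplus F_I$ be the projection. For Lagrangian $L\subset\mathbb{F}_2^{2n}$ set $L|_I:=\pi_I(L\cap W_I)\subset E_I\oplus F_I\cong\mathbb{F}_2^{2|I|}$, which is a Lagrangian subspace; the class $[L|_I]\in\mathcal{L}_{|I|}$ does not depend on the numbering of $I$. The counit is the projection of $\mathcal{L}$ onto $\mathcal{L}_0=\mathbb{K}$. Bialgebra of graphs: $\mathcal{G}=\bigoplus_{n\ge0}\mathcal{G}_n$, where $\mathcal{G}_n$ is freely spanned over $\mathbb{K}$ by (isomorphism classes of) finite simple graphs on $n$ vertices, not necessarily connected; multiplication is disjoint union with unit the empty graph; comultiplication is $\Delta(\Gamma)=\sum_{J\sqcup J'=V(\Gamma)}\Gamma_J\otimes\Gamma_{J'}$, where $\Gamma_J$ is the subgraph induced on the vertex set $J$; the counit is the projection onto $\mathcal{G}_0=\mathbb{K}$. For a graph $\Gamma$ with $n$ vertices, number the vertices arbitrarily and let $M(\Gamma)$ be the adjacency matrix over $\mathbb{F}_2$. $L(\Gamma)\subset\mathbb{F}_2^{2n}$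 is the Lagrangian subspace spanned by the rows of the $n\times 2n$ matrix $(\mathrm{Id}_n\mid M(\Gamma))$, where the first $n$ columns correspond to $e_1,\dots,e_n$ and the last $n$ to $f_1,\dots,f_n$. Its orbit $[L(\Gamma)]$ does not depend on the numbering. *)

(* Defs.v *)
From HB Require Import structures.
From mathcomp Require Import all_fingroup all_boot all_order all_algebra.
From mathcomp Require Import finmap.
From mathcomp.multinomials Require Import monalg.

Set Implicit Arguments.
Unset Strict Implicit.
Unset Printing Implicit Defensive.

Import GRing.Theory.
Local Open Scope ring_scope.
Local Open Scope quotient_scope.

(* -------------------------------------------------------------------- *)
(* The free K-module on B has the carrier {malg K[B]}, whose own lmodType *)
(* instance requires 1 != 0; the alias [freemod] gets a module structure  *)
(* over every commutative ring, the zero ring included.                   *)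

Definition freemod (K : comPzRingType) (B : choiceType) : Type := {malg K[B]}.

HB.instance Definition _ (K : comPzRingType) (B : choiceType) :=
  GRing.Zmodule.on (freemod K B).

Section FreeModule.
Context (K : comPzRingType) (B : choiceType).
Implicit Types (x y : freemod K B) (c : K).

Definition fm_scale c x : freemod K B := [malg b in msupp x => c * x@_b].

Lemma fm_scaleE c x b : (fm_scale c x)@_b = c * x@_b.
Proof. by rewrite mcoeffE; case: msuppP => // _; rewrite mulr0. Qed.

Lemma fm_scaleA c1 c2 x : fm_scale c1 (fm_scale c2 x) = fm_scale (c1 * c2) x.
Proof. by apply/malgP => b; rewrite !fm_scaleE mulrA. Qed.

Lemma fm_scale1 x : fm_scale 1 x = x.
Proof. by apply/malgP => b; rewrite fm_scaleE mul1r. Qed.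

Lemma fm_scaleDr c x y : fm_scale c (x + y) = fm_scale c x + fm_scale c y.
Proof. by apply/malgP => b; rewrite !(fm_scaleE, mcoeffD) mulrDr. Qed.

Lemma fm_scaleDl x c1 c2 :
  fm_scale (c1 + c2) x = fm_scale c1 x + fm_scale c2 x.
Proof. by apply/malgP => b; rewrite !(fm_scaleE, mcoeffD) mulrDl. Qed.

HB.instance Definition _ := GRing.Zmodule_isLmodule.Build K (freemod K B)
  fm_scaleA fm_scale1 fm_scaleDr fm_scaleDl.

Lemma freemodZE c x b : (c *: x : freemod K B)@_b = c * x@_b.
Proof. exact: fm_scaleE. Qed.

Definition bvec (b : B) : freemod K B := << 1 *g b >>.

Definition linext (M : lmodType K) (f : B -> M) x : M :=
  \sum_(b <- msupp x) x@_b *: f b.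

End FreeModule.

Arguments bvec {K B} b.

Section LinearExtension.
Context (K : comPzRingType) (B : choiceType) (M : lmodType K) (f : B -> M).

Lemma linextEw (x : freemod K B) (d : {fset B}) :
  (msupp x `<=` d)%fset -> linext f x = \sum_(b <- d) x@_b *: f b.
Proof.
move=> le; rewrite /linext (big_fset_incl _ le) // => b _ nb.
by rewrite (mcoeff_outdom nb) scale0r.
Qed.

Lemma linext_is_linear : linear (linext f : freemod K B -> M).
Proof.
move=> c x y; set d := (msupp x `|` msupp y `|` msupp (c *: x + y : freemod K B))%fset.
have sx : (msupp x `<=` d)%fset by rewrite /d -fsetUA fsubsetUl.
have sy : (msupp y `<=` d)%fset by rewrite /d -fsetUA fsetUCA fsubsetUl.
have sz : (msupp (c *: x + y : freemod K B) `<=` d)%fset by rewrite /d fsubsetUr.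
rewrite (linextEw sx) (linextEw sy) (linextEw sz) scaler_sumr -big_split /=.
by apply: eq_bigr => b _; rewrite mcoeffD freemodZE scalerDl scalerA.
Qed.

HB.instance Definition _ :=
  GRing.isLinear.Build K (freemod K B) M _ (linext f) linext_is_linear.

Lemma linext_bvec b : linext f (bvec b) = f b.
Proof.
rewrite (@linextEw _ [fset b]%fset) ?big_seq_fset1; last exact: msuppU_le.
by rewrite mcoeffUU scale1r.
Qed.

End LinearExtension.

Section FreeModuleTheory.
Context (K : comPzRingType) (B : choiceType).

Lemma freemodE (x : freemod K B) : x = linext bvec x.
Proof.
apply/malgP => b; rewrite /linext raddf_sum /=.
have E c : (x@_c *: bvec c : freemod K B)@_b = x@_c *+ (c == b).
  by rewrite freemodZE mcoeffU mulr_natr.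
rewrite (eq_bigr _ (fun c _ => E c)); case: (boolP (b \in msupp x)) => [inb|nb]; last first.
  rewrite big1_seq ?mcoeff_outdom // => c /andP[_ inc].
  by case: eqP nb => // <-; rewrite inc.
rewrite (big_fsetD1 b) //= eqxx big1_fset ?addr0 // => c.
by rewrite !inE => /andP[/negPf-> _] _.
Qed.

Lemma linear_freemod_eq (M : lmodType K) (f g : {linear freemod K B -> M}) :
  (forall b, f (bvec b) = g (bvec b)) -> f =1 g.
Proof.
move=> fg x; rewrite (freemodE x) /linext !linear_sum.
by apply: eq_bigr => b _; rewrite !linearZ /= fg.
Qed.

End FreeModuleTheory.

(* -------------------------------------------------------------------- *)
(* K[A] (x) K[B] is realised as K[A * B]; [tens_universal] is the         *)
(* universal property.                                                    *)

Section Tensor.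
Context (K : comPzRingType).

Definition tens (A B : choiceType) (x : freemod K A) (y : freemod K B) :
  freemod K (A * B)%type :=
  linext (fun a => linext (fun b => bvec (a, b)) y) x.

Definition tmap (A B C D : choiceType)
    (f : freemod K A -> freemod K C) (g : freemod K B -> freemod K D) :
    freemod K (A * B)%type -> freemod K (C * D)%type :=
  linext (fun p => tens (f (bvec p.1)) (g (bvec p.2))).

Definition tassoc (A B C : choiceType) :
    freemod K (A * B * C)%type -> freemod K (A * (B * C))%type :=
  linext (fun p => bvec (p.1.1, (p.1.2, p.2))).

Definition tswap (A B : choiceType) :
    freemod K (A * B)%type -> freemod K (B * A)%type :=
  linext (fun p => bvec (p.2, p.1)).

(* id (x) swap (x) id *)
Definition tmid (A B C D : choiceType) :
    freemod K ((A * B) * (C * D))%type -> freemod K ((A * C) * (B * D))%type :=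
  linext (fun p => bvec ((p.1.1, p.2.1), (p.1.2, p.2.2))).

(* f (x) id and id (x) f, composed with K (x) V = V and V (x) K = V *)
Definition tscal_l (A B : choiceType) (f : freemod K A -> K) :
    freemod K (A * B)%type -> freemod K B :=
  linext (fun p => f (bvec p.1) *: bvec p.2).

Definition tscal_r (A B : choiceType) (f : freemod K B -> K) :
    freemod K (A * B)%type -> freemod K A :=
  linext (fun p => f (bvec p.2) *: bvec p.1).

Lemma tens_bvec (A B : choiceType) (a : A) (b : B) :
  tens (bvec a) (bvec b) = bvec (a, b).
Proof. by rewrite /tens !linext_bvec. Qed.

Lemma tens_linear_l (A B : choiceType) (y : freemod K B) :
  linear (fun x : freemod K A => tens x y).
Proof. exact: linext_is_linear. Qed.

Lemma tens_linear_r (A B : choiceType) (x : freemod K A) :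
  linear (tens x : freemod K B -> _).
Proof.
move=> c y z; rewrite /tens ![linext _ x]/linext.
rewrite scaler_sumr -big_split /=; apply: eq_bigr => a _.
by rewrite linearP scalerDr !scalerA mulrC.
Qed.

Lemma tens_universal (A B : choiceType) (M : lmodType K)
    (g : freemod K A -> freemod K B -> M) :
  (forall y, linear (g^~ y)) -> (forall x, linear (g x)) ->
  exists2 h : {linear freemod K (A * B)%type -> M},
    (forall x y, h (tens x y) = g x y) &
    (forall h' : {linear freemod K (A * B)%type -> M},
       (forall x y, h' (tens x y) = g x y) -> h' =1 h).
Proof.
move=> gl gr; exists (linext (fun p => g (bvec p.1) (bvec p.2))).
  move=> x y.
  pose Gl z := HB.pack_for {linear freemod K A -> M} (g^~ z)
    (GRing.isLinear.Build _ _ _ _ (g^~ z) (gl z)).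
  pose Gr z := HB.pack_for {linear freemod K B -> M} (g z)
    (GRing.isLinear.Build _ _ _ _ (g z) (gr z)).
  rewrite [in RHS](freemodE x) -[RHS]/(Gl y _) /tens ![linext _ x]/linext.
  rewrite !linear_sum; apply: eq_bigr => a _; rewrite !linearZ /=.
  congr (_ *: _); rewrite [in RHS](freemodE y) -[RHS]/(Gr (bvec a) _).
  rewrite ![linext _ y]/linext !linear_sum; apply: eq_bigr => b _.
  by rewrite !linearZ /= linext_bvec.
move=> h' h'E; apply: linear_freemod_eq => -[a b].
by rewrite /= linext_bvec -tens_bvec h'E.
Qed.

End Tensor.

(* -------------------------------------------------------------------- *)
Record bialg_ops (K : comPzRingType) (B : choiceType) := BialgOps {
  bmul : {linear freemod K (B * B)%type -> freemod K B};
  bone : freemod K B;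
  bcomul : {linear freemod K B -> freemod K (B * B)%type};
  bcounit : {linear freemod K B -> K^o}
}.

Section Bialgebra.
Context (K : comPzRingType) (B : choiceType) (H : bialg_ops K B).
Local Notation V := (freemod K B).
Local Notation "x ** y" := (bmul H (tens x y)) (at level 40).

Definition alg_assoc := forall x y z : V, (x ** y) ** z = x ** (y ** z).

Definition alg_unital :=
  (forall x : V, bone H ** x = x) /\ (forall x : V, x ** bone H = x).

Definition alg_comm := forall x y : V, x ** y = y ** x.

Definition coalg_coassoc := forall x : V,
  tassoc (tmap (bcomul H) id (bcomul H x)) = tmap id (bcomul H) (bcomul H x).

Definition coalg_counital :=
  (forall x : V, tscal_l (bcounit H) (bcomul H x) = x) /\
  (forall x : V, tscal_r (bcounit H) (bcomul H x) = x).

Definition coalg_cocomm := forall x : V, tswap (bcomul H x) = bcomul H x.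

(* the product of V (x) V: (a (x) b) (c (x) d) = ac (x) bd *)
Definition tmul (s t : freemod K (B * B)%type) : freemod K (B * B)%type :=
  tmap (bmul H) (bmul H) (tmid (tens s t)).

Definition comul_alg_hom :=
  (forall x y : V, bcomul H (x ** y) = tmul (bcomul H x) (bcomul H y)) /\
  bcomul H (bone H) = tens (bone H) (bone H).

Definition counit_alg_hom :=
  (forall x y : V, bcounit H (x ** y) = (bcounit H x : K) * bcounit H y) /\
  bcounit H (bone H) = 1.

Definition is_bialgebra :=
  [/\ alg_assoc /\ alg_unital, coalg_coassoc /\ coalg_counital,
      comul_alg_hom & counit_alg_hom].

(* [deg] splits V into V_n = K[deg^-1 n]. *)
Variable deg : B -> nat.

Definition homog (n : nat) (x : V) := forall b, b \in msupp x -> deg b = n.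

Definition homog2 (n : nat) (t : freemod K (B * B)%type) :=
  forall p, p \in msupp t -> (deg p.1 + deg p.2)%N = n.

Definition is_graded :=
  [/\ forall p q x y, homog p x -> homog q y -> homog (p + q) (x ** y),
      homog 0 (bone H),
      forall n x, homog n x -> homog2 n (bcomul H x)
    & forall n x, homog n x -> n <> 0%N -> bcounit H x = 0].

End Bialgebra.

Definition is_bialgebra_hom (K : comPzRingType) (B B' : choiceType)
    (H : bialg_ops K B) (H' : bialg_ops K B')
    (f : {linear freemod K B -> freemod K B'}) :=
  [/\ forall x y, f (bmul H (tens x y)) = bmul H' (tens (f x) (f y)),
      f (bone H) = bone H',
      forall x, bcomul H' (f x) = tmap f f (bcomul H x)
    & forall x, bcounit H' (f x) = bcounit H x].

(* -------------------------------------------------------------------- *)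
(* A vector of F_2^{2n} is a row (u_1 .. u_n | u'_1 .. u'_n), standing    *)
(* for \sum_i u_i e_i + u'_i f_i.                                         *)

Notation symp n := 'rV['F_2]_(n + n).

Definition ebase n (i : 'I_n) : symp n := row_mx (delta_mx 0 i) 0.
Definition fbase n (i : 'I_n) : symp n := row_mx 0 (delta_mx 0 i).

Definition sform n (u v : symp n) : 'F_2 :=
  \sum_(i < n) (lsubmx u 0 i * rsubmx v 0 i - rsubmx u 0 i * lsubmx v 0 i).

Definition isotropic n (L : {vspace symp n}) :=
  [forall u : symp n, forall v : symp n,
     (u \in L) ==> (v \in L) ==> (sform u v == 0)].

Definition lagrangian n (L : {vspace symp n}) := isotropic L && (\dim L == n).

Record LGr n := Lagr { lagr_sub :> {vspace symp n}; _ : lagrangian lagr_sub }.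

HB.instance Definition _ n := [isSub for @lagr_sub n].
HB.instance Definition _ n := [Choice of LGr n by <:].

Lemma LGrP n (L : LGr n) : lagrangian L.
Proof. exact: valP. Qed.

(* For h injective: e_(h j) |-> e_j, f_(h j) |-> f_j, and the basis       *)
(* vectors with indices outside the image of h are sent to 0.             *)
Definition reindex n k (h : 'I_k -> 'I_n) (u : symp n) : symp k :=
  row_mx (colsub h (lsubmx u)) (colsub h (rsubmx u)).

Lemma reindex_is_linear n k (h : 'I_k -> 'I_n) : linear (@reindex n k h).
Proof.
move=> c u v; apply/rowP => j; rewrite !mxE.
by case: splitP => l _; rewrite !mxE.
Qed.

HB.instance Definition _ n k (h : 'I_k -> 'I_n) :=
  GRing.isLinear.Build _ _ _ _ (@reindex n k h) (@reindex_is_linear n k h).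

(* S_n acts by s . e_i = e_(s i), s . f_i = f_(s i). *)
Definition sym_act n (s : 'S_n) : symp n -> symp n := reindex (s^-1)%g.

Lemma sym_act_ebase n (s : 'S_n) i : sym_act s (ebase i) = ebase (s i).
Proof.
apply/rowP => j; rewrite /sym_act /reindex /ebase row_mxKl row_mxKr !mxE.
case: splitP => l _; rewrite !mxE ?eqxx //=.
by rewrite -(inj_eq (@perm_inj _ s)) permKV.
Qed.

Lemma sym_act_fbase n (s : 'S_n) i : sym_act s (fbase i) = fbase (s i).
Proof.
apply/rowP => j; rewrite /sym_act /reindex /fbase row_mxKl row_mxKr !mxE.
case: splitP => l _; rewrite !mxE ?eqxx //=.
by rewrite -(inj_eq (@perm_inj _ s)) permKV.
Qed.

HB.instance Definition _ n (s : 'S_n) := GRing.Linear.on (sym_act s).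

Definition same_orbit n (L L' : LGr n) : bool :=
  [exists s : 'S_n, (linfun (sym_act s) @: L)%VS == L'].

Lemma sym_act1 n : sym_act (1 : 'S_n)%g =1 id.
Proof.
move=> u; rewrite /sym_act /reindex -[RHS]hsubmxK.
by congr row_mx; apply/rowP => i; rewrite mxE invg1 perm1.
Qed.

Lemma sym_actM n (s t : 'S_n) u : sym_act (s * t)%g u = sym_act t (sym_act s u).
Proof.
rewrite /sym_act /reindex row_mxKl row_mxKr.
by congr row_mx; apply/rowP => i; rewrite !mxE invMg permM.
Qed.

Lemma same_orbit_refl n : reflexive (@same_orbit n).
Proof.
move=> L; apply/existsP; exists 1%g; apply/eqP; rewrite -[RHS]lim1g.
by apply: eq_in_limg => u _; rewrite !lfunE /= sym_act1.
Qed.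

Lemma same_orbit_trans n : transitive (@same_orbit n).
Proof.
move=> L2 L1 L3 /existsP[s /eqP E1] /existsP[t /eqP E2].
apply/existsP; exists (s * t)%g; apply/eqP; rewrite -E2 -E1 -limg_comp.
by apply: eq_in_limg => u _; rewrite lfunE comp_lfunE !lfunE /= sym_actM.
Qed.

Lemma same_orbit_sym n : symmetric (@same_orbit n).
Proof.
suff H L L' : @same_orbit n L L' -> same_orbit L' L.
  by move=> L L'; apply/idP/idP; apply: H.
case/existsP=> s /eqP E; apply/existsP; exists (s^-1)%g; apply/eqP.
rewrite -E -limg_comp -[RHS]lim1g; apply: eq_in_limg => u _.
by rewrite comp_lfunE !lfunE /= -sym_actM mulgV sym_act1.
Qed.

Canonical same_orbit_equiv n := EquivRel (@same_orbit n)
  (@same_orbit_refl n) (@same_orbit_sym n) (@same_orbit_trans n).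

Definition LGr_mod_S n := {eq_quot (@same_orbit n)}.

HB.instance Definition _ n := Choice.on (LGr_mod_S n).
HB.instance Definition _ n := EqQuotient.on (LGr_mod_S n).

(* The disjoint union of the sets LGr(n) / S_n, a basis of the algebra. *)
Definition Lorb := {n : nat & LGr_mod_S n}.

HB.instance Definition _ := Choice.on Lorb.

Definition Lclass n (L : LGr n) : Lorb := Tagged LGr_mod_S (\pi_(LGr_mod_S n) L).

Section Dimension.
Variable F : fieldType.

Definition basis_mx N (L : {vspace 'rV[F]_N}) : 'M[F]_(\dim L, N) :=
  \matrix_i (vbasis L)`_i.

Lemma basis_mx_rank N (L : {vspace 'rV[F]_N}) : \rank (basis_mx L) = \dim L.
Proof.
apply/eqP; rewrite -/(row_free _) -kermx_eq0; apply/eqP/row_matrixP => i.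
rewrite row0; set x := row i _.
have /eqP x0 : x *m basis_mx L == 0 by rewrite -row_mul mulmx_ker row0.
apply/rowP => j; rewrite [RHS]mxE.
have /freeP := basis_free (vbasisP L); apply => /=.
rewrite -[RHS]x0 mulmx_sum_row; apply: eq_bigr => k _.
by rewrite rowK.
Qed.

Lemma dim_orthogonal N (A B : {vspace 'rV[F]_N}) :
  (forall u v, u \in A -> v \in B -> u *m v^T = 0) -> (\dim A + \dim B <= N)%N.
Proof.
move=> AB; rewrite -(basis_mx_rank A) -(basis_mx_rank B) -(mxrank_tr (basis_mx B)).
apply: mulmx0_rank_max; apply/matrixP => i j.
have mA : (vbasis A)`_i \in A by rewrite vbasis_mem ?mem_nth ?size_tuple.
have mB : (vbasis B)`_j \in B by rewrite vbasis_mem ?mem_nth ?size_tuple.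
have /matrixP/(_ 0 0) := AB _ _ mA mB; rewrite !mxE => E.
by rewrite -[RHS]E; apply: eq_bigr => k _; rewrite !mxE.
Qed.

End Dimension.

Lemma isotropicP n (L : {vspace symp n}) :
  reflect (forall u v, u \in L -> v \in L -> sform u v = 0) (isotropic L).
Proof.
apply: (iffP 'forall_forallP) => [H u v uL vL|H u v].
  by have := H u v; rewrite uL vL => /eqP.
by apply/implyP => uL; apply/implyP => vL; rewrite H.
Qed.

Lemma isotropic_dim n (L : {vspace symp n}) : isotropic L -> (\dim L <= n)%N.
Proof.
move/isotropicP => H.
pose J (v : symp n) : symp n := row_mx (rsubmx v) (- lsubmx v).
have Jlin : linear J.
  move=> c u v; apply/rowP => i; rewrite !mxE.
  by case: splitP => k _; rewrite !mxE // opprD mulrN.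
pose Jl := HB.pack_for {linear symp n -> symp n} J
  (GRing.isLinear.Build _ _ _ _ J Jlin).
pose B := (linfun Jl @: L)%VS.
have dB : \dim B = \dim L.
  apply: limg_dim_eq; apply/eqP; rewrite -subv0; apply/subvP => u.
  rewrite memv_cap memv_ker lfunE memv0 => /andP[_ /eqP/= E].
  rewrite -[u]hsubmxK -row_mx0; apply/eqP; congr row_mx; apply/rowP => i.
    have /rowP/(_ (rshift n i)) := E; rewrite row_mxEr !mxE => /eqP.
    by rewrite oppr_eq0 => /eqP.
  by have /rowP/(_ (lshift n i)) := E; rewrite row_mxEl !mxE.
have : (\dim L + \dim B <= n + n)%N.
  apply: dim_orthogonal => u _ uL /memv_imgP[v vL ->].
  apply/rowP => i; rewrite lfunE /= /J -[u]hsubmxK tr_row_mx mul_row_col.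
  rewrite mxE [RHS]mxE -[RHS](H _ _ uL vL) /sform !mxE -big_split /=.
  by apply: eq_bigr => k _; rewrite !mxE ord1 mulrN.
by rewrite dB => le2; rewrite -leq_double -!addnn.
Qed.

(* -------------------------------------------------------------------- *)
Section Restriction.
Variable n : nat.
Implicit Types (L : LGr n) (I : {set 'I_n}).

Definition Wspace I : {vspace symp n} :=
  (\sum_(i in I) <[ebase i]> + \sum_(i < n) <[fbase i]>)%VS.

(* W_I -> E_I + F_I = F_2^{2|I|}, the elements of I being numbered in     *)
(* increasing order; on W_I the kernel is F_{~: I}.                       *)
Definition restr_proj I : symp n -> symp #|I| := reindex (@enum_val _ (mem I)).

HB.instance Definition _ I := GRing.Linear.on (restr_proj I).

Definition restr_sub L I : {vspace symp #|I|} :=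
  (linfun (restr_proj I) @: (L :&: Wspace I))%VS.

Lemma memW I (u : symp n) :
  reflect (forall i, i \notin I -> lsubmx u 0 i = 0) (u \in Wspace I).
Proof.
apply: (iffP idP) => [|H].
  case/memv_addP => x /memv_sumP[xs xsP ->] [y /memv_sumP[ys ysP ->] ->] i iI.
  rewrite linearD !linear_sum mxE !summxE !big1 ?addr0 // => j jI.
    have /vlineP[c ->] := ysP j jI.
    by rewrite linearZ /= row_mxKl scaler0 mxE.
  have /vlineP[c ->] := xsP j jI.
  rewrite linearZ /= row_mxKl !mxE eqxx /= [i == j]eq_sym.
  by case: eqP => [ji|]; rewrite ?mulr0 //; rewrite ji (negPf iI) in jI.
have -> : u = \sum_(i in I) lsubmx u 0 i *: ebase i
            + \sum_(i < n) rsubmx u 0 i *: fbase i.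
  rewrite -[LHS]hsubmxK -[RHS]hsubmxK; congr row_mx.
    rewrite linearD !linear_sum /= [X in _ + X]big1 ?addr0; last first.
      by move=> i _; rewrite linearZ /= row_mxKl scaler0.
    rewrite [LHS]row_sum_delta (bigID (mem I)) /= [X in _ + X]big1 ?addr0.
      by apply: eq_bigr => i _; rewrite linearZ /= row_mxKl.
    by move=> i /H ->; rewrite scale0r.
  rewrite linearD !linear_sum /= [X in X + _]big1 ?add0r; last first.
    by move=> i _; rewrite linearZ /= row_mxKr scaler0.
  rewrite [LHS]row_sum_delta.
  by apply: eq_bigr => i _; rewrite linearZ /= row_mxKr.
apply: memv_add; apply: memv_sumr => i _; exact: memvZ (memv_line _).
Qed.

Lemma sform_restr I (u v : symp n) : u \in Wspace I -> v \in Wspace I ->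
  sform (restr_proj I u) (restr_proj I v) = sform u v.
Proof.
move=> /memW uW /memW vW; rewrite /sform [RHS](bigID (mem I)) /=.
rewrite [X in _ = _ + X]big1 ?addr0; last first.
  by move=> i iI; rewrite uW // vW // mul0r mulr0 subr0.
rewrite [RHS]big_enum_val; apply: eq_bigr => k _.
by rewrite /restr_proj /reindex !row_mxKl !row_mxKr !mxE.
Qed.

Lemma restr_lagrangian L I : lagrangian (restr_sub L I).
Proof.
have /andP[/isotropicP Liso /eqP Ldim] := LGrP L.
have iso : isotropic (restr_sub L I).
  apply/isotropicP => _ _ /memv_imgP[u uL ->] /memv_imgP[v vL ->].
  move: uL vL; rewrite !memv_cap !lfunE /= => /andP[uL uW] /andP[vL vW].
  by rewrite sform_restr // Liso.
rewrite /lagrangian iso eqn_leq isotropic_dim //=.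
pose J := ~: I; pose h := @enum_val _ (mem J).
have hJ i : i \notin I -> exists k, h k = i.
  move=> iI; have iJ : i \in J by rewrite inE.
  by exists (enum_rank_in iJ i); rewrite /h enum_rankK_in.
have hI k : h k \notin I by have := enum_valP k; rewrite inE.
pose r (u : symp n) : 'rV_#|J| := colsub h (lsubmx u).
pose s (u : symp n) : 'rV_#|J| := colsub h (rsubmx u).
have rlin : linear r by move=> c u v; apply/rowP => k; rewrite !mxE.
have slin : linear s by move=> c u v; apply/rowP => k; rewrite !mxE.
pose rl := linfun (HB.pack_for {linear symp n -> 'rV_#|J|} r
  (GRing.isLinear.Build _ _ _ _ r rlin)).
pose sl := linfun (HB.pack_for {linear symp n -> 'rV_#|J|} s
  (GRing.isLinear.Build _ _ _ _ s slin)).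
have rE u : rl u = r u by rewrite lfunE.
have sE u : sl u = s u by rewrite lfunE.
have capE : (L :&: Wspace I = L :&: lker rl)%VS.
  apply/vspaceP => u; rewrite !memv_cap; congr (_ && _).
  rewrite memv_ker rE; apply/memW/eqP => [H|/rowP H i /hJ[k <-]].
    by apply/rowP => k; rewrite !mxE -[RHS](H _ (hI k)) mxE.
  by have := H k; rewrite !mxE.
pose P := linfun (restr_proj I).
pose X := (L :&: Wspace I)%VS; pose Y := (X :&: lker P)%VS.
have dX : (\dim X + \dim (rl @: L) = n)%N.
  by rewrite /X capE limg_ker_dim Ldim.
have dP : (\dim Y + \dim (restr_sub L I) = \dim X)%N by rewrite limg_ker_dim.
have dY : \dim (sl @: Y) = \dim Y.
  apply: limg_dim_eq; apply/eqP; rewrite -subv0; apply/subvP => u.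
  rewrite !memv_cap !memv_ker sE memv0 lfunE /=.
  move=> /andP[/andP[/andP[_ /memW uW] /eqP uP] /eqP us].
  rewrite -[u]hsubmxK -row_mx0; apply/eqP; congr row_mx; apply/rowP => i.
    case: (boolP (i \in I)) => iI; last by rewrite uW // mxE.
    have /rowP/(_ (lshift _ (enum_rank_in iI i))) := uP.
    by rewrite row_mxEl !mxE enum_rankK_in.
  case: (boolP (i \in I)) => iI.
    have /rowP/(_ (rshift _ (enum_rank_in iI i))) := uP.
    by rewrite row_mxEr !mxE enum_rankK_in.
  by have [k <-] := hJ _ iI; have /rowP/(_ k) := us; rewrite !mxE.
have le_ab : (\dim (rl @: L) + \dim (sl @: Y) <= #|J|)%N.
  apply: dim_orthogonal => _ _ /memv_imgP[u uL ->] /memv_imgP[v vY ->].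
  move: vY; rewrite !memv_cap memv_ker lfunE /= => /andP[/andP[vL vW] /eqP vP].
  have := Liso _ _ uL vL; rewrite /sform (bigID (mem I)) /= big1 ?add0r.
    move=> E; apply/rowP => i; rewrite ord1 mxE [RHS]mxE -[RHS]E.
    transitivity (\sum_(k in J) lsubmx u 0 k * rsubmx v 0 k).
      rewrite [RHS]big_enum_val; apply: eq_bigr => k _.
      by rewrite rE sE !mxE.
    apply: eq_big => [k|k]; rewrite inE // => kI.
    by rewrite (memW _ _ vW _ kI) mulr0 subr0.
  move=> i iI; have /rowP H := vP.
  have := H (rshift _ (enum_rank_in iI i)); have := H (lshift _ (enum_rank_in iI i)).
  rewrite row_mxEl row_mxEr !mxE enum_rankK_in // => -> ->.
  by rewrite !mulr0 subr0.
have cIJ : (#|I| + #|J| = n)%N by rewrite cardsC card_ord.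
have nE : (\dim (restr_sub L I) + (\dim (rl @: L) + \dim (sl @: Y)) = n)%N.
  by rewrite dY addnC -addnA dP addnC.
rewrite -(leq_add2r #|J|).
apply: (@leq_trans (\dim (restr_sub L I) + (\dim (rl @: L) + \dim (sl @: Y)))).
  by apply: eq_leq; rewrite [LHS]cIJ [RHS]nE.
by rewrite leq_add2l.
Qed.

Definition restr L I : LGr #|I| := Lagr (restr_lagrangian L I).

End Restriction.

(* -------------------------------------------------------------------- *)
(* Direct sums: F_2^{2n} takes the first n indices of F_2^{2(n+m)}, and   *)
(* F_2^{2m} the last m.                                                   *)

Section DirectSum.
Variables n m : nat.

Definition inj_l (u : symp n) : symp (n + m) :=
  row_mx (row_mx (lsubmx u) 0) (row_mx (rsubmx u) 0).

Definition inj_r (v : symp m) : symp (n + m) :=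
  row_mx (row_mx 0 (lsubmx v)) (row_mx 0 (rsubmx v)).

Lemma inj_l_is_linear : linear inj_l.
Proof.
move=> c u v; apply/rowP => i; rewrite !mxE.
by case: splitP => k _; rewrite !mxE; case: splitP => l _; rewrite !mxE ?mulr0 ?addr0.
Qed.

Lemma inj_r_is_linear : linear inj_r.
Proof.
move=> c u v; apply/rowP => i; rewrite !mxE.
by case: splitP => k _; rewrite !mxE; case: splitP => l _; rewrite !mxE ?mulr0 ?addr0.
Qed.

HB.instance Definition _ := GRing.isLinear.Build _ _ _ _ inj_l inj_l_is_linear.
HB.instance Definition _ := GRing.isLinear.Build _ _ _ _ inj_r inj_r_is_linear.

Definition dsum_sub (L1 : LGr n) (L2 : LGr m) : {vspace symp (n + m)} :=
  (linfun inj_l @: L1 + linfun inj_r @: L2)%VS.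

Lemma inj_lr_eq0 u v : inj_l u + inj_r v = 0 -> u = 0 /\ v = 0.
Proof.
rewrite /inj_l /inj_r !add_row_mx !addr0 !add0r => E.
have El k : row_mx (lsubmx u) (lsubmx v) 0 k = 0.
  by have /rowP/(_ (lshift _ k)) := E; rewrite row_mxEl => ->; rewrite mxE.
have Er k : row_mx (rsubmx u) (rsubmx v) 0 k = 0.
  by have /rowP/(_ (rshift _ k)) := E; rewrite row_mxEr => ->; rewrite mxE.
split; rewrite -[LHS]hsubmxK -row_mx0; congr row_mx; apply/rowP => i;
  rewrite [RHS]mxE.
- by rewrite -(El (lshift _ i)) row_mxEl.
- by rewrite -(Er (lshift _ i)) row_mxEl.
- by rewrite -(El (rshift _ i)) row_mxEr.
- by rewrite -(Er (rshift _ i)) row_mxEr.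
Qed.

Lemma sform_inj u u' v v' :
  sform (inj_l u + inj_r v) (inj_l u' + inj_r v') = sform u u' + sform v v'.
Proof.
rewrite /sform big_split_ord /inj_l /inj_r !add_row_mx !addr0 !add0r.
rewrite !row_mxKl !row_mxKr.
by congr (_ + _); apply: eq_bigr => i _; rewrite ?row_mxEl ?row_mxEr.
Qed.

Lemma dsum_lagrangian (L1 : LGr n) (L2 : LGr m) : lagrangian (dsum_sub L1 L2).
Proof.
have /andP[/isotropicP iso1 /eqP dim1] := LGrP L1.
have /andP[/isotropicP iso2 /eqP dim2] := LGrP L2.
apply/andP; split.
  apply/isotropicP => w w' /memv_addP[_ /memv_imgP[u uL ->]].
  move=> [_ /memv_imgP[v vL ->] ->] /memv_addP[_ /memv_imgP[u' uL' ->]].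
  move=> [_ /memv_imgP[v' vL' ->] ->].
  by rewrite !lfunE /= sform_inj iso1 // iso2 // addr0.
rewrite dimv_disjoint_sum.
  rewrite !limg_dim_eq ?dim1 ?dim2 //; apply/eqP; rewrite -subv0.
    apply/subvP => v; rewrite memv_cap memv_ker lfunE memv0 /= => /andP[_ /eqP v0].
    by have [|_ ->] := @inj_lr_eq0 0 v; rewrite ?v0 ?linear0 ?addr0.
  apply/subvP => u; rewrite memv_cap memv_ker lfunE memv0 /= => /andP[_ /eqP u0].
  by have [|-> _] := @inj_lr_eq0 u 0; rewrite ?u0 ?linear0 ?addr0.
apply/eqP; rewrite -subv0; apply/subvP => w; rewrite memv_cap memv0.
move=> /andP[/memv_imgP[u _ ->] /memv_imgP[v _]]; rewrite !lfunE /= => E.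
have [|-> _] := @inj_lr_eq0 u (- v); last by rewrite linear0.
by rewrite linearN /= E subrr.
Qed.

Definition dsum L1 L2 : LGr (n + m) := Lagr (dsum_lagrangian L1 L2).

End DirectSum.

Lemma zero_lagrangian : lagrangian (0 : {vspace symp 0}).
Proof.
rewrite /lagrangian dimv0 eqxx andbT; apply/isotropicP => u v _ _.
by rewrite /sform big_ord0.
Qed.

Definition L0 : LGr 0 := Lagr zero_lagrangian.

(* -------------------------------------------------------------------- *)
(* The operations on classes are computed on representatives; they do not *)
(* depend on this choice.                                                 *)

Definition Lorb_mul (p q : Lorb) : Lorb :=
  Lclass (dsum (repr (tagged p)) (repr (tagged q))).

Definition Lorb_comul (K : comPzRingType) (p : Lorb) :
    freemod K (Lorb * Lorb)%type :=
  \sum_(I : {set 'I_(tag p)})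
    tens (bvec (Lclass (restr (repr (tagged p)) I)))
         (bvec (Lclass (restr (repr (tagged p)) (~: I)))).

Definition Lalg (K : comPzRingType) : bialg_ops K Lorb := {|
  bmul := linext (fun pq => bvec (Lorb_mul pq.1 pq.2));
  bone := bvec (Lclass L0);
  bcomul := linext (@Lorb_comul K);
  bcounit := linext (fun p => (tag p == 0)%:R : K^o)
|}.

(* -------------------------------------------------------------------- *)
(* Simple graphs on 'I_n: symmetric irreflexive relations, stored as      *)
(* boolean matrices.                                                      *)

Definition is_sgraph n (e : 'M[bool]_n) := (e^T == e) && [forall i, ~~ e i i].

Record sgraph n := SGraph { adj :> 'M[bool]_n; _ : is_sgraph adj }.

HB.instance Definition _ n := [isSub for @adj n].
HB.instance Definition _ n := [Choice of sgraph n by <:].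

Lemma sgraphP n (G : sgraph n) : is_sgraph G.
Proof. exact: valP. Qed.

Definition giso n (G H : sgraph n) : bool :=
  [exists s : 'S_n, forall i, forall j, H (s i) (s j) == G i j].

Lemma giso_refl n : reflexive (@giso n).
Proof.
move=> G; apply/existsP; exists 1%g.
by apply/forallP => i; apply/forallP => j; rewrite !perm1.
Qed.

Lemma giso_sym n : symmetric (@giso n).
Proof.
suff H (G G' : sgraph n) : giso G G' -> giso G' G.
  by move=> G G'; apply/idP/idP; apply: H.
case/existsP=> s /'forall_forallP/= H; apply/existsP; exists (s^-1)%g.
apply/'forall_forallP => i j /=; have := H (s^-1 i)%g (s^-1 j)%g.
by rewrite !permKV eq_sym.
Qed.

Lemma giso_trans n : transitive (@giso n).
Proof.
move=> G2 G1 G3 /existsP[s /'forall_forallP/= Hs] /existsP[t /'forall_forallP/= Ht].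
apply/existsP; exists (s * t)%g; apply/'forall_forallP => i j /=.
by rewrite !permM (eqP (Ht _ _)) Hs.
Qed.

Canonical giso_equiv n := EquivRel (@giso n)
  (@giso_refl n) (@giso_sym n) (@giso_trans n).

Definition sgraph_mod_iso n := {eq_quot (@giso n)}.

HB.instance Definition _ n := Choice.on (sgraph_mod_iso n).
HB.instance Definition _ n := EqQuotient.on (sgraph_mod_iso n).

Definition gtype := {n : nat & sgraph_mod_iso n}.

HB.instance Definition _ := Choice.on gtype.

Definition gclass n (G : sgraph n) : gtype :=
  Tagged sgraph_mod_iso (\pi_(sgraph_mod_iso n) G).

Lemma empty_is_sgraph : is_sgraph (const_mx false : 'M_0).
Proof. by apply/andP; split; [rewrite trmx_const | apply/forallP => -[]]. Qed.

Definition gempty : sgraph 0 := SGraph empty_is_sgraph.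

Lemma gunion_is_sgraph n m (G : sgraph n) (H : sgraph m) :
  is_sgraph (block_mx G (const_mx false) (const_mx false) H).
Proof.
have /andP[/eqP Gs /forallP Gi] := sgraphP G.
have /andP[/eqP Hs /forallP Hi] := sgraphP H.
rewrite /is_sgraph tr_block_mx !trmx_const Gs Hs eqxx /=; apply/forallP => i.
by case: (split_ordP i) => k ->; rewrite ?block_mxEul ?block_mxEdr.
Qed.

Definition gunion n m (G : sgraph n) (H : sgraph m) : sgraph (n + m) :=
  SGraph (gunion_is_sgraph G H).

Lemma ginduced_is_sgraph n (G : sgraph n) (J : {set 'I_n}) :
  is_sgraph (mxsub (@enum_val _ (mem J)) (@enum_val _ (mem J)) G).
Proof.
have /andP[/eqP Gs /forallP Gi] := sgraphP G.
by rewrite /is_sgraph trmx_mxsub Gs eqxx; apply/forallP => i; rewrite mxE.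
Qed.

Definition ginduced n (G : sgraph n) (J : {set 'I_n}) : sgraph #|J| :=
  SGraph (ginduced_is_sgraph G J).

Definition gtype_mul (p q : gtype) : gtype :=
  gclass (gunion (repr (tagged p)) (repr (tagged q))).

Definition gtype_comul (K : comPzRingType) (p : gtype) :
    freemod K (gtype * gtype)%type :=
  \sum_(J : {set 'I_(tag p)})
    tens (bvec (gclass (ginduced (repr (tagged p)) J)))
         (bvec (gclass (ginduced (repr (tagged p)) (~: J)))).

Definition Galg (K : comPzRingType) : bialg_ops K gtype := {|
  bmul := linext (fun pq => bvec (gtype_mul pq.1 pq.2));
  bone := bvec (gclass gempty);
  bcomul := linext (@gtype_comul K);
  bcounit := linext (fun p => (tag p == 0)%:R : K^o)
|}.

(* -------------------------------------------------------------------- *)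
Section GraphLagrangian.
Variables (n : nat) (G : sgraph n).

Definition adj_mx : 'M['F_2]_n := map_mx (fun b : bool => b%:R) G.

Definition graph_sub : {vspace symp n} :=
  <<[seq row i (row_mx 1%:M adj_mx) | i : 'I_n]>>%VS.

Lemma mem_graph_sub (u : symp n) :
  u \in graph_sub -> exists x : 'rV_n, u = row_mx x (x *m adj_mx).
Proof.
rewrite /graph_sub span_def big_image => /memv_sumP[us usP ->].
have c i : {c | us i = c *: row i (row_mx 1%:M adj_mx)}.
  by apply: sig_eqW; have /vlineP[c ->] := usP i isT; exists c.
exists (\row_i sval (c i)); rewrite -[X in row_mx X _]mulmx1 -mul_mx_row mulmx_sum_row.
by apply: eq_bigr => i _; rewrite mxE; exact: (svalP (c i)).
Qed.

Lemma graph_lagrangian : lagrangian graph_sub.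
Proof.
have /andP[/eqP Gs _] := sgraphP G.
have Ms : adj_mx^T = adj_mx by rewrite /adj_mx map_trmx Gs.
have iso : isotropic graph_sub.
  apply/isotropicP => _ _ /mem_graph_sub[x ->] /mem_graph_sub[y ->].
  rewrite /sform !row_mxKl !row_mxKr sumrB.
  have E (a b : 'rV['F_2]_n) : \sum_(i < n) a 0 i * b 0 i = (a *m b^T) 0 0.
    by rewrite mxE; apply: eq_bigr => i _; rewrite mxE.
  by rewrite !E trmx_mul Ms mulmxA subrr.
rewrite /lagrangian iso eqn_leq isotropic_dim //=.
pose f := linfun (@lsubmx 'F_2 1 n n).
suff : (\dim (fullv : {vspace 'rV['F_2]_n}) <= \dim graph_sub)%N.
  by rewrite dimvf /dim /= mul1n.
have <- : (f @: graph_sub = fullv)%VS.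
  apply/vspaceP => x; rewrite memvf; apply/memv_imgP.
  exists (row_mx x (x *m adj_mx)); last by rewrite lfunE /= row_mxKl.
  rewrite -[X in row_mx X _]mulmx1 -mul_mx_row mulmx_sum_row.
  by apply: rpred_sum => i _; apply: memvZ; apply: memv_span; apply: image_f.
by rewrite -(limg_ker_dim f graph_sub) leq_addl.
Qed.

Definition graphL : LGr n := Lagr graph_lagrangian.

End GraphLagrangian.

Definition graph_embed (K : comPzRingType) :
    {linear freemod K gtype -> freemod K Lorb} :=
  linext (fun p : gtype => bvec (Lclass (graphL (repr (tagged p))))).

(* Main.v *)
Require Import Defs.
From HB Require Import structures.
From mathcomp Require Import all_fingroup all_boot all_order all_algebra.
From mathcomp Require Import finmap ring.
From mathcomp.multinomials Require Import monalg.

Set Implicit Arguments.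
Unset Strict Implicit.
Unset Printing Implicit Defensive.

Import GRing.Theory.
Local Open Scope ring_scope.

(** Every axiom is an identity between classes of combinatorial structures.
   Structures with restriction along injections and with a sum that is
   associative, commutative, unital and compatible with restriction always
   give a commutative and cocommutative bialgebra: coassociativity compares the
   two ways of enumerating ordered partitions of the points in three blocks,
   and multiplicativity of the coproduct splits a subset of the points of a sum
   into its traces on the two summands. A map of structures that respects
   restriction and sum induces a bialgebra homomorphism.

   For Lagrangian subspaces, the restriction of [L] along [h] consists of the
   reindexed vectors of [L] without [e]-components outside the image of [h].
   Equalities of Lagrangian subspaces reduce to inclusions, by dimension. The
   embedding of graphs is injective because the row of index [i] of
   [(Id | M)] is the only vector of [L(Gamma)] whose [e]-part is [e_i]. *)

(** * Free modules *)

(** These maps are [linext]s hidden behind definitions; the instances make [linearP] and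
    [linear_sum] applicable to them. *)
HB.instance Definition _ (K : comPzRingType) (A B C D : choiceType)
    (f : freemod K A -> freemod K C) (g : freemod K B -> freemod K D) :=
  GRing.Linear.on (tmap f g).
HB.instance Definition _ (K : comPzRingType) (A B C : choiceType) :=
  GRing.Linear.on (@tassoc K A B C).
HB.instance Definition _ (K : comPzRingType) (A B : choiceType) :=
  GRing.Linear.on (@tswap K A B).
HB.instance Definition _ (K : comPzRingType) (A B C D : choiceType) :=
  GRing.Linear.on (@tmid K A B C D).
HB.instance Definition _ (K : comPzRingType) (A B : choiceType)
    (f : freemod K A -> K) := GRing.Linear.on (@tscal_l K A B f).
HB.instance Definition _ (K : comPzRingType) (A B : choiceType)
    (f : freemod K B -> K) := GRing.Linear.on (@tscal_r K A B f).

Section FreeModules.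
Context (K : comPzRingType).
Implicit Types A B C D : choiceType.

(** Linearity is an unbundled hypothesis, so that composites such as [fun x => f (tens x y)] need no
    structure of their own. *)
Lemma freemod_ext B (M : lmodType K) (f g : freemod K B -> M) :
  linear f -> linear g -> (forall b, f (bvec b) = g (bvec b)) -> f =1 g.
Proof.
move=> fl gl; pose f' := HB.pack_for {linear freemod K B -> M} f
  (GRing.isLinear.Build _ _ _ _ f fl).
pose g' := HB.pack_for {linear freemod K B -> M} g
  (GRing.isLinear.Build _ _ _ _ g gl).
exact: (@linear_freemod_eq _ _ _ f' g').
Qed.

Lemma tensPl A B c (x x' : freemod K A) (y : freemod K B) :
  tens (c *: x + x') y = c *: tens x y + tens x' y.
Proof. exact: tens_linear_l. Qed.

Lemma tensPr A B c (x : freemod K A) (y y' : freemod K B) :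
  tens x (c *: y + y') = c *: tens x y + tens x y'.
Proof. exact: tens_linear_r. Qed.

Lemma tens_suml A B I (r : seq I) (P : pred I) (F : I -> freemod K A) (y : freemod K B) :
  tens (\sum_(i <- r | P i) F i) y = \sum_(i <- r | P i) tens (F i) y.
Proof.
pose f := HB.pack_for {linear freemod K A -> freemod K (A * B)%type}
  (fun x => tens x y) (GRing.isLinear.Build _ _ _ _ _ (tens_linear_l y)).
exact: (linear_sum f).
Qed.

Lemma tens_sumr A B I (r : seq I) (P : pred I) (x : freemod K A) (F : I -> freemod K B) :
  tens x (\sum_(i <- r | P i) F i) = \sum_(i <- r | P i) tens x (F i).
Proof.
pose f := HB.pack_for {linear freemod K B -> freemod K (A * B)%type}
  (tens x) (GRing.isLinear.Build _ _ _ _ _ (tens_linear_r x)).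
exact: (linear_sum f).
Qed.

Lemma linear_linext B (M : lmodType K) (f : {linear freemod K B -> M}) x :
  f x = linext (fun b => f (bvec b)) x.
Proof. by move: x; apply: linear_freemod_eq => b; rewrite /= linext_bvec. Qed.

(** Presents a product as an iterated [linext], the form in which [msupp_linext] controls its
    support. *)
Lemma tens_linext A B (M : lmodType K) (f : {linear freemod K (A * B)%type -> M}) x y :
  f (tens x y) = linext (fun a => linext (fun b => f (bvec (a, b))) y) x.
Proof.
move: x; apply: freemod_ext => [c u v|c u v|a]; rewrite ?tensPl ?linearP ?linext_bvec //.
move: y; apply: freemod_ext => [c u v|c u v|b]; rewrite ?tensPr ?linearP ?linext_bvec //.
by rewrite tens_bvec.
Qed.

Lemma tmap_bvec A B C D (f : freemod K A -> freemod K C)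
    (g : freemod K B -> freemod K D) a b :
  tmap f g (bvec (a, b)) = tens (f (bvec a)) (g (bvec b)).
Proof. exact: linext_bvec. Qed.

Lemma linext_bvec_inj B C (f : B -> C) :
  injective f -> injective (linext (fun b => bvec (f b)) : freemod K B -> freemod K C).
Proof.
move=> fI x y E; apply/malgP => b.
(* Since [f] is injective, no two basis vectors merge and each coefficient can be read off the
   image. *)
suff coefE z : (linext (fun b => bvec (f b)) z : freemod K C)@_(f b) = z@_b.
  by rewrite -!coefE E.
rewrite [in RHS](freemodE z) /linext !raddf_sum /=; apply: eq_bigr => c _.
by rewrite !freemodZE !mcoeffU (inj_eq fI).
Qed.

Lemma msupp_bvec B (b c : B) : c \in msupp (bvec b : freemod K B) -> c = b.
Proof. by move/(fsubsetP msuppU_le); rewrite inE => /eqP. Qed.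

Lemma msupp_linext A B (P : B -> Prop) (f : A -> freemod K B) (x : freemod K A) :
  (forall a, a \in msupp x -> forall b, b \in msupp (f a) -> P b) ->
  forall b, b \in msupp (linext f x) -> P b.
Proof.
move=> fP b bx; case: (boolP (has (fun a => b \in msupp (f a)) (msupp x))).
  by case/hasP=> a ax ba; exact: fP ba.
move/hasPn => nb; move: bx; rewrite -mcoeff_neq0 /linext raddf_sum /= big1_seq ?eqxx //.
by move=> a /andP[_ ax]; rewrite freemodZE (mcoeff_outdom (nb _ ax)) mulr0.
Qed.

Lemma msupp_sum I (r : seq I) B (P : B -> Prop) (F : I -> freemod K B) :
  (forall i b, b \in msupp (F i) -> P b) ->
  forall b, b \in msupp (\sum_(i <- r) F i : freemod K B) -> P b.
Proof.
move=> FP b; elim: r => [|i r IH]; first by rewrite big_nil msupp0 inE.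
rewrite big_cons => /(fsubsetP (msuppD_le _ _)); rewrite inE.
by case/orP => [/FP|/IH].
Qed.

End FreeModules.

(** * Restrictions along injections *)

Definition ord_sum n m k l (h : 'I_k -> 'I_n) (g : 'I_l -> 'I_m) (i : 'I_(k + l)) :
    'I_(n + m) :=
  match split i with inl j => lshift m (h j) | inr j => rshift n (g j) end.

Definition ord_swap n m (i : 'I_(m + n)) : 'I_(n + m) :=
  match split i with inl j => rshift n j | inr j => lshift m j end.

Lemma ord_suml n m k l (h : 'I_k -> 'I_n) (g : 'I_l -> 'I_m) j :
  ord_sum h g (lshift l j) = lshift m (h j).
Proof. by rewrite /ord_sum -[lshift l j]/(unsplit (inl j)) unsplitK. Qed.

Lemma ord_sumr n m k l (h : 'I_k -> 'I_n) (g : 'I_l -> 'I_m) j :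
  ord_sum h g (rshift k j) = rshift n (g j).
Proof. by rewrite /ord_sum -[rshift k j]/(unsplit (inr j)) unsplitK. Qed.

Lemma ord_swapl n m j : ord_swap (lshift n j) = rshift n j :> 'I_(n + m).
Proof. by rewrite /ord_swap -[lshift n j]/(unsplit (inl j)) unsplitK. Qed.

Lemma ord_swapr n m j : ord_swap (rshift m j) = lshift m j :> 'I_(n + m).
Proof. by rewrite /ord_swap -[rshift m j]/(unsplit (inr j)) unsplitK. Qed.

Lemma ord_swapK n m : cancel (@ord_swap n m) (@ord_swap m n).
Proof.
by move=> i; case: (split_ordP i) => j ->; rewrite ?ord_swapl ?ord_swapr ?ord_swapl.
Qed.

Lemma ord_swap_bij n m : bijective (@ord_swap n m).
Proof. exact: Bijective (@ord_swapK n m) (@ord_swapK m n). Qed.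

Lemma ord_sum_inj n m k l (h : 'I_k -> 'I_n) (g : 'I_l -> 'I_m) :
  injective h -> injective g -> injective (ord_sum h g).
Proof.
move=> hI gI i j; case: (split_ordP i) => a ->; case: (split_ordP j) => b ->;
  rewrite ?ord_suml ?ord_sumr => /eqP;
  rewrite ?eq_lshift ?eq_rshift ?eq_lrshift ?eq_rlshift // => /eqP.
- by move/hI->.
- by move/gI->.
Qed.

Lemma inj_ord_bij n k (h : 'I_k -> 'I_n) : k = n -> injective h -> bijective h.
Proof. by move=> E hI; apply: inj_card_bij => //; rewrite !card_ord E. Qed.

Lemma bij_ord_eq n k (h : 'I_k -> 'I_n) : bijective h -> k = n.
Proof. by move/bij_eq_card; rewrite !card_ord. Qed.

Lemma ord_sum_bij n m k l (h : 'I_k -> 'I_n) (g : 'I_l -> 'I_m) :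
  bijective h -> bijective g -> bijective (ord_sum h g).
Proof.
move=> hB gB; apply: inj_ord_bij; first by rewrite (bij_ord_eq hB) (bij_ord_eq gB).
exact: ord_sum_inj (bij_inj hB) (bij_inj gB).
Qed.

(** Two numberings of the same subset differ by a bijection, which sends [j] to the preimage of
    [g j] under [h]. *)
Lemma inj_codom_factor n k l (h : 'I_k -> 'I_n) (g : 'I_l -> 'I_n) :
  injective h -> injective g -> codom h =i codom g ->
  exists2 p : 'I_l -> 'I_k, bijective p & g =1 h \o p.
Proof.
move=> hI gI hg.
have gh j : g j \in codom h by rewrite hg codom_f.
exists (fun j => iinv (gh j)) => [|j]; last by rewrite /= f_iinv.
apply: inj_ord_bij => [|i j E]; last by apply: gI; rewrite -(f_iinv (gh i)) E f_iinv.
by have := eq_card hg; rewrite !card_codom // !card_ord.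
Qed.

Lemma codom_enum_val n (I : {set 'I_n}) : codom (@enum_val _ (mem I)) =i I.
Proof.
move=> i; apply/codomP/idP => [[j ->]|iI]; first exact: enum_valP.
by exists (enum_rank_in iI i); rewrite enum_rankK_in.
Qed.

(** Direct and inverse image along the numbering of [I] are mutually inverse between the subsets of
    ['I_#|I|] and those of [I]. An iterated coproduct thus becomes a sum over subsets of the
    original points. *)
Lemma big_subset_enum_val n (V : nmodType) (I : {set 'I_n}) (F : {set 'I_n} -> V) :
  \sum_(J : {set 'I_#|I|}) F (@enum_val _ (mem I) @: J)
  = \sum_(A : {set 'I_n} | A \subset I) F A.
Proof.
set h := @enum_val _ _; have hI : injective h := enum_val_inj.
symmetry; rewrite (reindex_onto (fun J : {set 'I_#|I|} => h @: J) (fun A => h @^-1: A)) /=.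
  apply: eq_bigl => J; apply/andP; split.
    by apply/subsetP => _ /imsetP[j _ ->]; apply: enum_valP.
  by apply/eqP/setP => j; rewrite inE mem_imset.
move=> A AI; apply/setP => i; apply/imsetP/idP => [[j + ->]|iA]; first by rewrite inE.
have iI := subsetP AI _ iA.
by exists (enum_rank_in iI i); rewrite ?inE /h enum_rankK_in.
Qed.

(** * Subsets of a sum of two index sets *)

Definition set_sum n m (I : {set 'I_n}) (J : {set 'I_m}) : {set 'I_(n + m)} :=
  @lshift n m @: I :|: @rshift n m @: J.

Lemma mem_set_suml n m (I : {set 'I_n}) (J : {set 'I_m}) i :
  (lshift m i \in set_sum I J) = (i \in I).
Proof.
rewrite inE mem_imset; last exact: lshift_inj.
rewrite orbC; case: imsetP => // -[j _ /eqP]; by rewrite eq_lrshift.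
Qed.

Lemma mem_set_sumr n m (I : {set 'I_n}) (J : {set 'I_m}) j :
  (rshift n j \in set_sum I J) = (j \in J).
Proof.
rewrite inE [X in _ || X]mem_imset; last exact: rshift_inj.
case: imsetP => // -[i _ /eqP]; by rewrite eq_rlshift.
Qed.

Lemma big_set_sum n m (V : nmodType) (F : {set 'I_(n + m)} -> V) :
  \sum_I F I = \sum_(I : {set 'I_n}) \sum_(J : {set 'I_m}) F (set_sum I J).
Proof.
rewrite pair_bigA /= (reindex (fun p => set_sum p.1 p.2)) //.
exists (fun I : {set 'I_(n + m)} => (@lshift n m @^-1: I, @rshift n m @^-1: I)) => [[I J]|I] _ /=.
  by congr pair; apply/setP => i; rewrite inE ?mem_set_suml ?mem_set_sumr.
by apply/setP => i; case: (split_ordP i) => j ->;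
  rewrite ?mem_set_suml ?mem_set_sumr inE.
Qed.

Lemma setC_set_sum n m (I : {set 'I_n}) (J : {set 'I_m}) :
  ~: set_sum I J = set_sum (~: I) (~: J).
Proof.
by apply/setP => i; case: (split_ordP i) => j ->;
  rewrite inE ?mem_set_suml ?mem_set_sumr inE.
Qed.

(** * Algebras of combinatorial structures *)

(* [sp_rel h x y] says that [y] is the restriction of [x] along the injection  *)
(* [h], the point [j] of [y] being the point [h j] of [x]; for a bijective [h] *)
(* it says that [h] is an isomorphism.                                         *)
Record species := Species {
  sp_obj :> nat -> Type;
  sp_cls : choiceType;
  sp_rel : forall n k, ('I_k -> 'I_n) -> sp_obj n -> sp_obj k -> Prop;
  sp_restr : forall n, sp_obj n -> forall I : {set 'I_n}, sp_obj #|I|;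
  sp_sum : forall n m, sp_obj n -> sp_obj m -> sp_obj (n + m);
  sp_unit : sp_obj 0;
  sp_cl : forall n, sp_obj n -> sp_cls;
  sp_rel_comp : forall n k l (h : 'I_k -> 'I_n) (g : 'I_l -> 'I_k) x y z,
    injective h -> sp_rel h x y -> sp_rel g y z -> sp_rel (h \o g) x z;
  sp_rel_factor : forall n k l (h : 'I_k -> 'I_n) (g : 'I_l -> 'I_n)
      (p : 'I_l -> 'I_k) x y z,
    injective h -> g =1 h \o p -> sp_rel h x y -> sp_rel g x z -> sp_rel p y z;
  sp_rel_restr : forall n (x : sp_obj n) (I : {set 'I_n}),
    sp_rel (@enum_val _ (mem I)) x (sp_restr x I);
  sp_rel_sum : forall n m k l (h : 'I_k -> 'I_n) (g : 'I_l -> 'I_m) x x' y y',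
    sp_rel h x x' -> sp_rel g y y' ->
    sp_rel (ord_sum h g) (sp_sum x y) (sp_sum x' y');
  sp_rel_sumC : forall n m (x : sp_obj n) (y : sp_obj m),
    sp_rel (@ord_swap n m) (sp_sum x y) (sp_sum y x);
  sp_rel_sumA : forall n m p (x : sp_obj n) (y : sp_obj m) (z : sp_obj p),
    sp_rel (cast_ord (addnA n m p))
      (sp_sum (sp_sum x y) z) (sp_sum x (sp_sum y z));
  sp_rel_sum0 : forall n (x : sp_obj n),
    sp_rel (@lshift n 0) (sp_sum x sp_unit) x;
  sp_cl_rel : forall n k (h : 'I_k -> 'I_n) (x : sp_obj n) (y : sp_obj k),
    bijective h -> sp_rel h x y -> sp_cl x = sp_cl y;
  sp_cl_eq : forall n k (x : sp_obj n) (y : sp_obj k),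
    sp_cl x = sp_cl y -> exists2 h : 'I_k -> 'I_n, bijective h & sp_rel h x y;
  sp_cl_surj : forall b, exists n, exists x : sp_obj n, sp_cl x = b
}.

Arguments sp_rel {s n k}.
Arguments sp_cl {s n}.

(** * Classes of restrictions and of sums *)

Section SpeciesClasses.
Context (S : species).

(** The class of a restriction depends only on the image of the injection: the bijection between the
    two numberings is an isomorphism by [sp_rel_factor]. The identities between restrictions below
    compare two images. *)
Lemma sp_cl_codom n k l (h : 'I_k -> 'I_n) (g : 'I_l -> 'I_n) (x : S n) y z :
  injective h -> injective g -> codom h =i codom g ->
  sp_rel h x y -> sp_rel g x z -> sp_cl y = sp_cl z.
Proof.
move=> hI gI hg hxy gxz; have [p pB gE] := inj_codom_factor hI gI hg.
exact: sp_cl_rel pB (sp_rel_factor hI gE hxy gxz).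
Qed.

Lemma sp_cl_sumC n m (x : S n) (y : S m) :
  sp_cl (sp_sum x y) = sp_cl (sp_sum y x).
Proof. exact: sp_cl_rel (ord_swap_bij n m) (sp_rel_sumC x y). Qed.

Lemma sp_cl_sumA n m p (x : S n) (y : S m) (z : S p) :
  sp_cl (sp_sum (sp_sum x y) z) = sp_cl (sp_sum x (sp_sum y z)).
Proof.
apply: sp_cl_rel (sp_rel_sumA x y z).
by apply: inj_ord_bij (@cast_ord_inj _ _ _); rewrite addnA.
Qed.

Lemma sp_cl_sum0 n (x : S n) : sp_cl (sp_sum x (sp_unit S)) = sp_cl x.
Proof.
apply: sp_cl_rel (sp_rel_sum0 x).
by apply: inj_ord_bij (@lshift_inj _ _); rewrite addn0.
Qed.

Lemma sp_cl_sum n m k l (x : S n) (x' : S k) (y : S m) (y' : S l) :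
  sp_cl x = sp_cl x' -> sp_cl y = sp_cl y' ->
  sp_cl (sp_sum x y) = sp_cl (sp_sum x' y').
Proof.
move=> /sp_cl_eq[h hB hx] /sp_cl_eq[g gB gy].
exact: sp_cl_rel (ord_sum_bij hB gB) (sp_rel_sum hx gy).
Qed.

Lemma sp_cl_restr n k (h : 'I_k -> 'I_n) (x : S n) (y : S k) (J : {set 'I_k}) :
  injective h -> sp_rel h x y ->
  sp_cl (sp_restr y J) = sp_cl (sp_restr x (h @: J)).
Proof.
move=> hI hxy; have xJ := sp_rel_comp hI hxy (sp_rel_restr y J).
apply: (sp_cl_codom _ _ _ xJ (sp_rel_restr x (h @: J))).
- exact: inj_comp hI enum_val_inj.
- exact: enum_val_inj.
move=> i; rewrite codom_enum_val; apply/codomP/imsetP => [[j ->]|[j jJ ->]].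
  by exists (enum_val j); rewrite ?enum_valP.
by exists (enum_rank_in jJ j); rewrite /= enum_rankK_in.
Qed.

Lemma sp_cl_restrT n (x : S n) : sp_cl (sp_restr x setT) = sp_cl x.
Proof.
symmetry; apply: sp_cl_rel (sp_rel_restr x setT).
by apply: inj_ord_bij; [rewrite cardsT card_ord | exact: enum_val_inj].
Qed.

(** Both structures are restrictions of [sp_sum x y] along injections with image [set_sum I J]. *)
Lemma sp_cl_restr_sum n m (x : S n) (y : S m) I J :
  sp_cl (sp_restr (sp_sum x y) (set_sum I J))
  = sp_cl (sp_sum (sp_restr x I) (sp_restr y J)).
Proof.
have xy := sp_rel_sum (sp_rel_restr x I) (sp_rel_restr y J).
apply: (sp_cl_codom _ _ _ (sp_rel_restr _ _) xy).
- exact: enum_val_inj.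
- exact: ord_sum_inj enum_val_inj enum_val_inj.
move=> i; rewrite codom_enum_val; apply/idP/codomP => [|[j ->]].
  case: (split_ordP i) => j ->; rewrite ?mem_set_suml ?mem_set_sumr => jIJ.
    by exists (lshift _ (enum_rank_in jIJ j)); rewrite ord_suml enum_rankK_in.
  by exists (rshift _ (enum_rank_in jIJ j)); rewrite ord_sumr enum_rankK_in.
by case: (split_ordP j) => {}j ->; rewrite ?ord_suml ?ord_sumr
  ?mem_set_suml ?mem_set_sumr enum_valP.
Qed.

Lemma sp_cl_restr_restr n (x : S n) (I : {set 'I_n}) (J : {set 'I_#|I|}) :
  sp_cl (sp_restr (sp_restr x I) J)
  = sp_cl (sp_restr x (@enum_val _ (mem I) @: J)).
Proof. exact: sp_cl_restr enum_val_inj (sp_rel_restr x I). Qed.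

End SpeciesClasses.

(** * The bialgebra axioms for the classes of a species *)

Section SpeciesBialgebra.
Context (K : comPzRingType) (S : species).

(** The operations are described on arbitrary representatives, which keeps the choice made by [repr]
    out of the proofs of the axioms. *)
Record species_ops (H : bialg_ops K (sp_cls S)) : Prop := SpeciesOps {
  sp_mulE : forall n m (x : S n) (y : S m),
    bmul H (tens (bvec (sp_cl x)) (bvec (sp_cl y))) = bvec (sp_cl (sp_sum x y));
  sp_oneE : bone H = bvec (sp_cl (sp_unit S));
  sp_comulE : forall n (x : S n),
    bcomul H (bvec (sp_cl x)) =
    \sum_(I : {set 'I_n})
      tens (bvec (sp_cl (sp_restr x I))) (bvec (sp_cl (sp_restr x (~: I))));
  sp_counitE : forall n (x : S n), bcounit H (bvec (sp_cl x)) = (n == 0%N)%:R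
}.

Lemma sp_ext (M : lmodType K) (f g : freemod K (sp_cls S) -> M) :
  linear f -> linear g ->
  (forall n (x : S n), f (bvec (sp_cl x)) = g (bvec (sp_cl x))) -> f =1 g.
Proof.
move=> fl gl fg; apply: freemod_ext => // b.
by have [n [x <-]] := sp_cl_surj b.
Qed.

Lemma imset_enum_valC n (I : {set 'I_n}) (J : {set 'I_#|I|}) :
  @enum_val _ (mem I) @: (~: J) = I :\: @enum_val _ (mem I) @: J.
Proof.
apply/setP => i; apply/imsetP/idP => [[j jJ ->]|].
  by rewrite !inE (mem_imset _ _ enum_val_inj) enum_valP -in_setC jJ.
rewrite inE => /andP[iJ iI]; exists (enum_rank_in iI i); last by rewrite enum_rankK_in.
rewrite inE; apply: contra iJ => iJ; apply/imsetP.
by exists (enum_rank_in iI i); rewrite ?enum_rankK_in.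
Qed.

(** Independence of the representative: an isomorphism [h] carries subsets to subsets bijectively,
    and it commutes with complements. *)
Lemma comul_cl n k (x : S n) (y : S k) : sp_cl x = sp_cl y ->
  \sum_(I : {set 'I_n})
      tens (bvec (sp_cl (sp_restr x I))) (bvec (sp_cl (sp_restr x (~: I))))
  = \sum_(I : {set 'I_k})
      tens (bvec (sp_cl (sp_restr y I))) (bvec (sp_cl (sp_restr y (~: I))))
    :> freemod K (sp_cls S * sp_cls S)%type.
Proof.
case/sp_cl_eq=> h hB hxy; have hI := bij_inj hB; have [h' hK h'K] := hB.
have imK : bijective (fun I : {set 'I_k} => h @: I).
  exists (fun I : {set 'I_n} => h' @: I) => I; rewrite -imset_comp -[RHS]imset_id;
  by apply: eq_imset => i; rewrite /= ?hK ?h'K.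
rewrite (reindex _ (onW_bij _ imK)); apply: eq_bigr => I _.
rewrite !(sp_cl_restr _ hI hxy); congr (tens _ (bvec (sp_cl (sp_restr x _)))).
by apply/setP => i; rewrite -[i]h'K inE !mem_imset // inE.
Qed.

Context (H : bialg_ops K (sp_cls S)) (HS : species_ops H).

Let mulE := sp_mulE HS.
Let comulE := sp_comulE HS.
Let counitE := sp_counitE HS.
Let oneE := sp_oneE HS.

Lemma sp_alg_assoc : alg_assoc H.
Proof.
move=> x y z; move: x; apply: sp_ext => [c u v|c u v|n x].
- by rewrite !(tensPl, linearP).
- by rewrite !(tensPl, linearP).
move: y; apply: sp_ext => [c u v|c u v|m y].
- by rewrite !(tensPl, tensPr, linearP).
- by rewrite !(tensPl, tensPr, linearP).
move: z; apply: sp_ext => [c u v|c u v|p z].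
- by rewrite !(tensPr, linearP).
- by rewrite !(tensPr, linearP).
by rewrite !mulE sp_cl_sumA.
Qed.

Lemma sp_alg_comm : alg_comm H.
Proof.
move=> x y; move: x; apply: sp_ext => [c u v|c u v|n x].
- by rewrite tensPl linearP.
- by rewrite tensPr linearP.
move: y; apply: sp_ext => [c u v|c u v|m y].
- by rewrite tensPr linearP.
- by rewrite tensPl linearP.
by rewrite !mulE sp_cl_sumC.
Qed.

Lemma sp_alg_unital : alg_unital H.
Proof.
have unitr : forall x, bmul H (tens x (bone H)) = x.
  apply: sp_ext => [c u v|c u v|n x]; rewrite ?tensPl ?linearP //.
  by rewrite oneE mulE sp_cl_sum0.
by split=> // x; rewrite sp_alg_comm unitr.
Qed.

Lemma sp_coalg_cocomm : coalg_cocomm H.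
Proof.
apply: sp_ext => [c u v|c u v|n x]; rewrite ?linearP //.
rewrite comulE linear_sum (reindex_inj (@setC_inj _)); apply: eq_bigr => I _.
by rewrite setCK !tens_bvec /= /tswap linext_bvec.
Qed.

Lemma sp_coalg_counital : coalg_counital H.
Proof.
have counitr : forall x, tscal_r (bcounit H) (bcomul H x) = x.
  apply: sp_ext => [c u v|c u v|n x]; rewrite ?linearP //.
  (* The counit kills every term whose second factor has points, so only the full set
     contributes. *)
  rewrite comulE linear_sum (bigD1 setT) //= big1 ?addr0 => [|I IT].
    by rewrite tens_bvec /tscal_r linext_bvec /= counitE setCT cards0 scale1r sp_cl_restrT.
  rewrite tens_bvec /tscal_r linext_bvec /= counitE cards_eq0.
  by rewrite -(inj_eq (@setC_inj _)) setCK setC0 (negPf IT) scale0r.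
(* The left law follows from the right one by cocommutativity, because [tscal_l] after [tswap] is
   [tscal_r]. *)
split=> // x; rewrite -[X in _ = X]counitr -[bcomul H x in LHS]sp_coalg_cocomm.
move: (bcomul H x); apply: freemod_ext => [c u v|c u v|[a b]]; rewrite ?linearP //.
by rewrite /tswap /tscal_l /tscal_r !linext_bvec.
Qed.

Lemma sp_coalg_coassoc : coalg_coassoc H.
Proof.
apply: sp_ext => [c u v|c u v|n x]; rewrite ?linearP //.
pose X (I : {set 'I_n}) := sp_cl (sp_restr x I).
(* A restriction of a restriction is a restriction of [x], so the second coproduct splits [I] into
   [A] and [I :\: A]. *)
have comul2 I : bcomul H (bvec (X I)) =
    \sum_(A : {set 'I_n} | A \subset I) bvec (X A, X (I :\: A)).
  rewrite comulE -big_subset_enum_val; apply: eq_bigr => J _.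
  by rewrite tens_bvec !sp_cl_restr_restr imset_enum_valC.
rewrite comulE (linear_sum (tmap (bcomul H) id)) (linear_sum (@tassoc _ _ _ _)).
rewrite (linear_sum (tmap id (bcomul H))).
transitivity (\sum_(I : {set 'I_n}) \sum_(A : {set 'I_n} | A \subset I)
    bvec (X A, (X (I :\: A), X (~: I))) : freemod K _).
  apply: eq_bigr => I _; rewrite tens_bvec /= tmap_bvec comul2 tens_suml linear_sum.
  by apply: eq_bigr => A _; rewrite tens_bvec /= /tassoc linext_bvec.
transitivity (\sum_(I : {set 'I_n}) \sum_(A : {set 'I_n} | A \subset ~: I)
    bvec (X I, (X A, X (~: I :\: A))) : freemod K _); last first.
  apply: eq_bigr => I _; rewrite tens_bvec /= tmap_bvec comul2 tens_sumr.
  by apply: eq_bigr => A _; rewrite tens_bvec.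
rewrite !pair_big_dep /=.
(* On the left the last block is split off first, on the right the first one. The right-hand pair
   with blocks [I], [A] and the rest corresponds to the left-hand pair of [I :|: A] and [I]. That
   the inverse recovers the pair means that [A] is disjoint from [I], which is the condition
   [A \subset ~: I]. *)
rewrite (reindex_onto (fun p : {set 'I_n} * {set 'I_n} => (p.1 :|: p.2, p.1))
  (fun p => (p.2, p.1 :\: p.2))) /=.
  apply: eq_big => [[I A]|[I A]] /=; rewrite subsetUl /=.
    rewrite subsets_disjoint setCK disjoint_sym -setI_eq0 xpair_eqE eqxx /=.
    rewrite setDUl setDv set0U; apply/eqP/eqP => [/setDidPl|IA]; last apply/setDidPl.
      by rewrite -setI_eq0 setIC => /eqP.
    by rewrite -setI_eq0 setIC IA.
  move=> /eqP[IA]; rewrite IA; congr (bvec (_, (_, X _))).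
  by rewrite setCU setDE.
move=> [I A] /= AI; congr pair; apply/setP => i; rewrite !inE.
by case: (boolP (i \in A)) => //= /(subsetP AI) ->.
Qed.

Lemma sp_comul_alg_hom : comul_alg_hom H.
Proof.
split; last first.
  (* The coproduct of the unit has a single term, as there is only one subset of no points. *)
  have E (I J : {set 'I_0}) : I = J by apply/setP => -[].
  rewrite oneE comulE (big_pred1 setT) => [|I]; last by rewrite (E I setT) /= eqxx.
  by rewrite (E (~: setT) setT) sp_cl_restrT.
move=> x y; move: x; apply: sp_ext => [c u v|c u v|n x].
- by rewrite tensPl !linearP.
- by rewrite /tmul linearP tensPl !linearP.
move: y; apply: sp_ext => [c u v|c u v|m y].
- by rewrite tensPr !linearP.
- by rewrite /tmul linearP tensPr !linearP.
(* After splitting each subset of the sum into its traces [I] and [J], the two sides agree term by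
   term. *)
rewrite mulE !comulE big_set_sum /tmul tens_suml (linear_sum (@tmid _ _ _ _ _)).
rewrite (linear_sum (tmap (bmul H) (bmul H))); apply: eq_bigr => I _.
rewrite tens_sumr (linear_sum (@tmid _ _ _ _ _)).
rewrite (linear_sum (tmap (bmul H) (bmul H))); apply: eq_bigr => J _.
rewrite !tens_bvec /= /tmid linext_bvec tmap_bvec /= -!tens_bvec !mulE.
by rewrite setC_set_sum !sp_cl_restr_sum.
Qed.

Lemma sp_counit_alg_hom : counit_alg_hom H.
Proof.
split; last by rewrite oneE counitE.
move=> x y; move: x; apply: sp_ext => [c u v|c u v|n x].
- by rewrite tensPl !linearP.
- by rewrite linearP /= mulrDl -mulrA.
move: y; apply: sp_ext => [c u v|c u v|m y].
- by rewrite tensPr !linearP.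
- by rewrite linearP /= mulrDr mulrCA.
by rewrite mulE !counitE addn_eq0 -natrM mulnb.
Qed.

Theorem species_bialgebra : is_bialgebra H.
Proof.
split; [split | split | |].
- exact: sp_alg_assoc.
- exact: sp_alg_unital.
- exact: sp_coalg_coassoc.
- exact: sp_coalg_counital.
- exact: sp_comul_alg_hom.
- exact: sp_counit_alg_hom.
Qed.

(** Homogeneity bears on supports, so the operations are expanded on basis vectors. There the sizes
    of a sum add up, and those of a subset and its complement add up to [n]. *)
Lemma species_graded (deg : sp_cls S -> nat) :
  (forall n (x : S n), deg (sp_cl x) = n) -> is_graded H deg.
Proof.
move=> degE; split=> [p q x y xp yq|c|n x xn|n x xn n0].
- rewrite tens_linext; apply: msupp_linext => a ax; apply: msupp_linext => b yb.
  rewrite -(xp _ ax) -(yq _ yb) -tens_bvec.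
  have [i [u <-]] := sp_cl_surj a; have [j [v <-]] := sp_cl_surj b.
  by rewrite mulE => c /msupp_bvec->; rewrite !degE.
- by rewrite oneE => /msupp_bvec->; rewrite degE.
- rewrite linear_linext; apply: msupp_linext => a ax; rewrite -(xn _ ax).
  have [i [u <-]] := sp_cl_surj a; rewrite comulE; apply: msupp_sum => I p.
  by rewrite tens_bvec => /msupp_bvec->; rewrite !degE cardsC card_ord.
- rewrite linear_linext /linext big1_seq // => a /andP[_ ax].
  have := xn _ ax; have [i [u <-]] := sp_cl_surj a; rewrite degE counitE => in0.
  have /negPf-> : i != 0%N by rewrite in0; apply/eqP.
  by rewrite scaler0.
Qed.

End SpeciesBialgebra.

Lemma species_hom (K : comPzRingType) (S T : species) (phi : forall n, S n -> T n)
    (H : bialg_ops K (sp_cls S)) (H' : bialg_ops K (sp_cls T))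
    (f : {linear freemod K (sp_cls S) -> freemod K (sp_cls T)}) :
  species_ops H -> species_ops H' ->
  (forall n k (h : 'I_k -> 'I_n) x y,
     injective h -> sp_rel h x y -> sp_rel h (phi n x) (phi k y)) ->
  (forall n m (x : S n) (y : S m),
     sp_cl (phi _ (sp_sum x y)) = sp_cl (sp_sum (phi _ x) (phi _ y))) ->
  sp_cl (phi _ (sp_unit S)) = sp_cl (sp_unit T) ->
  (forall n (x : S n), f (bvec (sp_cl x)) = bvec (sp_cl (phi _ x))) ->
  is_bialgebra_hom H H' f.
Proof.
move=> HS HT phi_rel phi_sum phi_unit fE.
(* Both are restrictions of [phi n x] along the same numbering of [I]. *)
have phi_restr n (x : S n) I : sp_cl (phi _ (sp_restr x I)) = sp_cl (sp_restr (phi _ x) I).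
  have := phi_rel _ _ _ _ _ enum_val_inj (sp_rel_restr x I).
  by move/sp_cl_codom => /(_ _ _ _ enum_val_inj enum_val_inj (fun=> erefl)
    (sp_rel_restr (phi n x) I)).
split.
- move=> x y; move: x; apply: sp_ext => [c u v|c u v|n x].
  + by rewrite tensPl !linearP.
  + by rewrite !(linearP, tensPl).
  move: y; apply: sp_ext => [c u v|c u v|m y].
  + by rewrite tensPr !linearP.
  + by rewrite !(linearP, tensPr).
  by rewrite (sp_mulE HS) !fE (sp_mulE HT) phi_sum.
- by rewrite (sp_oneE HS) (sp_oneE HT) fE phi_unit.
- apply: sp_ext => [c u v|c u v|n x]; rewrite ?linearP //.
  rewrite fE (sp_comulE HS) (sp_comulE HT) (linear_sum (tmap f f)).
  by apply: eq_bigr => I _; rewrite !tens_bvec /= tmap_bvec !fE tens_bvec !phi_restr.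
- apply: sp_ext => [c u v|c u v|n x]; rewrite ?linearP //.
  by rewrite fE (sp_counitE HS) (sp_counitE HT).
Qed.

(** * Simple graphs *)

Section Graphs.

Definition graph_rel n k (h : 'I_k -> 'I_n) (G : sgraph n) (H : sgraph k) :=
  forall i j, H i j = G (h i) (h j).

Lemma bij_codom n k (h : 'I_k -> 'I_n) i : bijective h -> i \in codom h.
Proof. by case=> h' _ h'K; rewrite -[i]h'K codom_f. Qed.

Lemma cast_ord_addnA n m p :
  [/\ forall i, cast_ord (addnA n m p) (lshift (m + p) i) = lshift p (lshift m i),
      forall i, cast_ord (addnA n m p) (rshift n (lshift p i)) = lshift p (rshift n i)
    & forall i, cast_ord (addnA n m p) (rshift n (rshift m i)) = rshift (n + m) i].
Proof. by split=> i; apply: val_inj; rewrite //= addnA. Qed.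

Lemma graph_rel_comp n k l (h : 'I_k -> 'I_n) (g : 'I_l -> 'I_k) x y z :
  injective h -> graph_rel h x y -> graph_rel g y z -> graph_rel (h \o g) x z.
Proof. by move=> _ xy yz i j; rewrite yz xy. Qed.

Lemma graph_rel_factor n k l (h : 'I_k -> 'I_n) (g : 'I_l -> 'I_n) (p : 'I_l -> 'I_k) x y z :
  injective h -> g =1 h \o p -> graph_rel h x y -> graph_rel g x z -> graph_rel p y z.
Proof. by move=> _ gE xy xz i j; rewrite xz xy !gE. Qed.

Lemma graph_rel_induced n (G : sgraph n) (I : {set 'I_n}) :
  graph_rel (@enum_val _ (mem I)) G (ginduced G I).
Proof. by move=> i j; rewrite mxE. Qed.

Let block_mxEE n m :=
  (@block_mxEul bool n m n m, @block_mxEur bool n m n m,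
   @block_mxEdl bool n m n m, @block_mxEdr bool n m n m).

Lemma graph_rel_union n m k l (h : 'I_k -> 'I_n) (g : 'I_l -> 'I_m) x x' y y' :
  graph_rel h x x' -> graph_rel g y y' -> graph_rel (ord_sum h g) (gunion x y) (gunion x' y').
Proof.
move=> hx gy i j; case: (split_ordP i) => a ->; case: (split_ordP j) => b ->;
  by rewrite ?ord_suml ?ord_sumr /= ?block_mxEE ?hx ?gy // !mxE.
Qed.

Lemma graph_rel_unionC n m (x : sgraph n) (y : sgraph m) :
  graph_rel (@ord_swap n m) (gunion x y) (gunion y x).
Proof.
move=> i j; case: (split_ordP i) => a ->; case: (split_ordP j) => b ->;
  by rewrite ?ord_swapl ?ord_swapr /= ?block_mxEE // !mxE.
Qed.

Lemma graph_rel_unionA n m p (x : sgraph n) (y : sgraph m) (z : sgraph p) :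
  graph_rel (cast_ord (addnA n m p)) (gunion (gunion x y) z) (gunion x (gunion y z)).
Proof.
have [E1 E2 E3] := cast_ord_addnA n m p.
move=> i j; case: (split_ordP i) => [a ->|{}i ->]; last case: (split_ordP i) => [a ->|a ->];
  (case: (split_ordP j) => [b ->|{}j ->]; last case: (split_ordP j) => [b ->|b ->]);
  rewrite ?E1 ?E2 ?E3 /= ?block_mxEE // !mxE //;
  by rewrite ?block_mxEE ?mxE.
Qed.

Lemma graph_rel_union0 n (x : sgraph n) : graph_rel (@lshift n 0) (gunion x gempty) x.
Proof. by move=> i j; rewrite /= block_mxEul. Qed.

Lemma gclass_rel n k (h : 'I_k -> 'I_n) (x : sgraph n) (y : sgraph k) :
  bijective h -> graph_rel h x y -> gclass x = gclass y.
Proof.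
move=> hB; have E := bij_ord_eq hB; subst k => xy.
(* [giso x y] asks for a map from the points of [x] to those of [y], whereas [h] goes the other
   way. *)
congr (Tagged _ _); apply/eqmodP; rewrite /= giso_sym; apply/existsP.
exists (perm (bij_inj hB)); apply/'forall_forallP => i j /=.
by rewrite !permE xy.
Qed.

Lemma gclass_eq n k (x : sgraph n) (y : sgraph k) : gclass x = gclass y ->
  exists2 h : 'I_k -> 'I_n, bijective h & graph_rel h x y.
Proof.
move=> E; have nk : n = k := congr1 (@tag _ _) E; subst k.
move/eqP: E; rewrite eq_Tagged => /eqP/eqmodP; rewrite /= giso_sym.
case/existsP=> s /'forall_forallP/= sE; exists s; first exact: inj_ord_bij perm_inj.
by move=> i j; apply/esym/eqP.
Qed.

Lemma gclass_surj (b : gtype) : exists n, exists x : sgraph n, gclass x = b.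
Proof. by case: b => n q; exists n, (repr q); rewrite /gclass reprK. Qed.

Definition graph_species : species :=
  Species graph_rel_comp graph_rel_factor graph_rel_induced graph_rel_union graph_rel_unionC graph_rel_unionA
    graph_rel_union0 gclass_rel gclass_eq gclass_surj.

Lemma graph_species_ops (K : comPzRingType) :
  species_ops (Galg K : bialg_ops K (sp_cls graph_species)).
Proof.
(* The operations of [Galg] act on chosen representatives, which are only known to have the right
   class. *)
have reprE n (x : sgraph n) : gclass (repr (tagged (gclass x))) = gclass x.
  by rewrite /gclass reprK.
split=> [n m x y||n x|n x] //.
- rewrite tens_bvec /= linext_bvec; congr bvec.
  by apply: (@sp_cl_sum graph_species); apply: reprE.
- by rewrite /= linext_bvec; apply: (@comul_cl _ graph_species); apply: reprE.
- by rewrite /= linext_bvec.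
Qed.

End Graphs.

(** * Lagrangian subspaces *)

Section Symplectic.
Context (n : nat).
Implicit Types (u v w : symp n) (L : LGr n).

Lemma sympP u v :
  (forall i, lsubmx u 0 i = lsubmx v 0 i) ->
  (forall i, rsubmx u 0 i = rsubmx v 0 i) -> u = v.
Proof.
by move=> El Er; rewrite -[u]hsubmxK -[v]hsubmxK; congr row_mx; apply/rowP.
Qed.

Lemma sformPl c u v w : sform (c *: u + v) w = c * sform u w + sform v w.
Proof.
rewrite /sform mulr_sumr -big_split; apply: eq_bigr => i _ /=.
rewrite !mxE; ring.
Qed.

Lemma sformC u v : sform u v = - sform v u.
Proof. by rewrite /sform -sumrN; apply: eq_bigr => i _; ring. Qed.

Lemma sform_alt u : sform u u = 0.
Proof. by rewrite /sform big1 // => i _; ring. Qed.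

(** Adding [w] to [L] keeps it isotropic, and an isotropic subspace has dimension at most [n], which
    [L] already attains. *)
Lemma LGr_maximal L w : (forall u, u \in L -> sform u w = 0) -> w \in L.
Proof.
move=> Lw; have /andP[/isotropicP Liso /eqP Ldim] := LGrP L.
have iso : isotropic (L + <[w]>)%VS.
  apply/isotropicP => u' v' /memv_addP[u uL [x /vlineP[c ->] ->]] 
    /memv_addP[v vL [y /vlineP[d ->] ->]].
  rewrite (addrC u) (addrC v) sformPl 2!(sformC _ (d *: w + v)) !sformPl.
  by rewrite sform_alt [sform w u]sformC !Lw // (Liso v u) // !(mulr0, addr0, oppr0).
have E : (lagr_sub L = L + <[w]>)%VS.
  by apply/eqP; rewrite eqEdim addvSl Ldim isotropic_dim.
by rewrite E (subvP (addvSr L _)) ?memv_line.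
Qed.

Lemma LGr_sub_eq L (L' : LGr n) : {subset L <= L'} -> L = L'.
Proof.
move=> LL'; have /andP[_ /eqP dL] := LGrP L; have /andP[_ /eqP dL'] := LGrP L'.
by apply/val_inj/eqP; rewrite eqEdim dL dL' leqnn andbT; apply/subvP.
Qed.

End Symplectic.

Lemma lsubmx_reindex n k (h : 'I_k -> 'I_n) u j :
  lsubmx (Defs.reindex h u) 0 j = lsubmx u 0 (h j).
Proof. by rewrite /Defs.reindex row_mxKl mxE. Qed.

Lemma rsubmx_reindex n k (h : 'I_k -> 'I_n) u j :
  rsubmx (Defs.reindex h u) 0 j = rsubmx u 0 (h j).
Proof. by rewrite /Defs.reindex row_mxKr mxE. Qed.

(** This is membership in W_I for I the image of [h], with no reference to the increasing numbering
    of I. *)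
Definition supported n k (h : 'I_k -> 'I_n) (u : symp n) :=
  forall i, i \notin codom h -> lsubmx u 0 i = 0.

Lemma supported_bij n k (h : 'I_k -> 'I_n) u : bijective h -> supported h u.
Proof. by move=> hB i; rewrite bij_codom. Qed.

Lemma sform_reindex n k (h : 'I_k -> 'I_n) (u v : symp n) :
  injective h -> supported h u -> supported h v ->
  sform (Defs.reindex h u) (Defs.reindex h v) = sform u v.
Proof.
move=> hI hu hv; rewrite /sform [RHS](bigID (mem (codom h))) /=.
rewrite [X in _ = _ + X]big1 ?addr0; last first.
  by move=> i ih; rewrite hu // hv // mul0r mulr0 subr0.
rewrite -big_uniq /=; last by rewrite map_inj_uniq ?enum_uniq.
rewrite big_map big_enum; apply: eq_bigr => j _.
by rewrite !lsubmx_reindex !rsubmx_reindex.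
Qed.

(* As both sides have dimension [k], the inclusion of [L'] in the restriction *)
(* of [L] is an equality: see [Lrel_reindex].                                 *)
Definition Lrel n k (h : 'I_k -> 'I_n) (L : LGr n) (L' : LGr k) :=
  forall w, w \in L' -> exists v, [/\ v \in L, supported h v & w = Defs.reindex h v].

(** Reindexing preserves the form on supported vectors, so the reindexed [v] is orthogonal to all of
    [L'], and [L'] is maximal. *)
Lemma Lrel_reindex n k (h : 'I_k -> 'I_n) (L : LGr n) (L' : LGr k) v :
  injective h -> Lrel h L L' -> v \in L -> supported h v -> Defs.reindex h v \in L'.
Proof.
move=> hI LL' vL hv; apply: LGr_maximal => _ /LL'[u [uL hu ->]].
have /andP[/isotropicP Liso _] := LGrP L.
by rewrite sform_reindex // Liso.
Qed.

Lemma reindex_comp n k l (h : 'I_k -> 'I_n) (g : 'I_l -> 'I_k) (f : 'I_l -> 'I_n) u :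
  f =1 h \o g -> Defs.reindex g (Defs.reindex h u) = Defs.reindex f u.
Proof.
by move=> fE; apply: sympP => i;
  rewrite !(lsubmx_reindex, rsubmx_reindex) fE.
Qed.

Lemma Lrel_comp n k l (h : 'I_k -> 'I_n) (g : 'I_l -> 'I_k) x y z :
  injective h -> Lrel h x y -> Lrel g y z -> Lrel (h \o g) x z.
Proof.
move=> hI xy yz w /yz[_ [/xy[u [ux hu ->]] gv ->]]; exists u; split => //.
  (* An index in the image of [h] comes from some [j] outside the image of [g], where the reindexed
     vector has no e-component. *)
  move=> i ihg; case: (boolP (i \in codom h)) => [/codomP[j ij]|/hu //].
  rewrite ij -lsubmx_reindex gv //; apply: contra ihg => /codomP[a ja].
  by apply/codomP; exists a; rewrite /= -ja.
exact: reindex_comp.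
Qed.

Lemma Lrel_factor n k l (h : 'I_k -> 'I_n) (g : 'I_l -> 'I_n) (p : 'I_l -> 'I_k) x y z :
  injective h -> g =1 h \o p -> Lrel h x y -> Lrel g x z -> Lrel p y z.
Proof.
move=> hI gE xy xz w /xz[u [ux gu ->]]; exists (Defs.reindex h u).
(* The image of [g] lies in that of [h], so [u] can be reindexed along [h] and lands in [y] by
   [Lrel_reindex]. *)
have hu : supported h u.
  move=> i ih; apply: gu; apply: contra ih => /codomP[a ->].
  by rewrite gE /= codom_f.
split; [exact: Lrel_reindex xy ux hu | | by rewrite (reindex_comp _ gE)].
move=> i ip; rewrite lsubmx_reindex gu //; apply: contra ip => /codomP[a].
by rewrite gE => /hI->; apply: codom_f.
Qed.

Lemma Lrel_restr n (L : LGr n) (I : {set 'I_n}) :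
  Lrel (@enum_val _ (mem I)) L (restr L I).
Proof.
move=> _ /memv_imgP[v + ->]; rewrite memv_cap => /andP[vL /memW vI].
exists v; split=> //; last by rewrite lfunE.
by move=> i; rewrite codom_enum_val => /vI.
Qed.

Definition symp_sum n m (u : symp n) (v : symp m) : symp (n + m) := inj_l m u + inj_r n v.

Lemma symp_sumE n m (u : symp n) (v : symp m) :
  symp_sum u v = row_mx (row_mx (lsubmx u) (lsubmx v)) (row_mx (rsubmx u) (rsubmx v)).
Proof. by rewrite /symp_sum /inj_l /inj_r !add_row_mx !(addr0, add0r). Qed.

Lemma symp_sum_coord n m (u : symp n) (v : symp m) :
  [/\ forall i, lsubmx (symp_sum u v) 0 (lshift m i) = lsubmx u 0 i,
      forall i, lsubmx (symp_sum u v) 0 (rshift n i) = lsubmx v 0 i,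
      forall i, rsubmx (symp_sum u v) 0 (lshift m i) = rsubmx u 0 i
    & forall i, rsubmx (symp_sum u v) 0 (rshift n i) = rsubmx v 0 i].
Proof.
by rewrite symp_sumE !(row_mxKl, row_mxKr); split=> i; rewrite ?row_mxEl ?row_mxEr.
Qed.

Lemma symp_sumP n m (w : symp (n + m)) u v :
  (forall i, lsubmx w 0 (lshift m i) = lsubmx u 0 i) ->
  (forall i, lsubmx w 0 (rshift n i) = lsubmx v 0 i) ->
  (forall i, rsubmx w 0 (lshift m i) = rsubmx u 0 i) ->
  (forall i, rsubmx w 0 (rshift n i) = rsubmx v 0 i) -> symp_sum u v = w.
Proof.
move=> lu lv ru rv; have [E1 E2 E3 E4] := symp_sum_coord u v.
by apply: sympP => i; case: (split_ordP i) => j ->;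
  rewrite ?E1 ?E2 ?E3 ?E4 ?lu ?lv ?ru ?rv.
Qed.

Lemma mem_dsum n m (L1 : LGr n) (L2 : LGr m) u v :
  u \in L1 -> v \in L2 -> symp_sum u v \in dsum L1 L2.
Proof.
move=> uL vL; apply: memv_add; apply/memv_imgP.
  by exists u => //; rewrite lfunE.
by exists v => //; rewrite lfunE.
Qed.

Lemma dsum_mem n m (L1 : LGr n) (L2 : LGr m) w : w \in dsum L1 L2 ->
  exists u v, [/\ u \in L1, v \in L2 & w = symp_sum u v].
Proof.
case/memv_addP=> _ /memv_imgP[u uL ->] [_ /memv_imgP[v vL ->] ->].
by exists u, v; rewrite !lfunE.
Qed.

Lemma Lrel_sum n m k l (h : 'I_k -> 'I_n) (g : 'I_l -> 'I_m) x x' y y' :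
  Lrel h x x' -> Lrel g y y' -> Lrel (ord_sum h g) (dsum x y) (dsum x' y').
Proof.
move=> hx gy _ /dsum_mem[_ [_ [/hx[u [ux hu ->]] /gy[v [vy gv ->]] ->]]].
have [E1 E2 E3 E4] := symp_sum_coord u v.
exists (symp_sum u v); split; first exact: mem_dsum.
  move=> i; case: (split_ordP i) => j -> {i} ij; rewrite ?E1 ?E2.
    apply: hu; apply: contra ij => /codomP[a ->].
    by apply/codomP; exists (lshift l a); rewrite ord_suml.
  apply: gv; apply: contra ij => /codomP[a ->].
  by apply/codomP; exists (rshift k a); rewrite ord_sumr.
by apply: symp_sumP => i; rewrite !(lsubmx_reindex, rsubmx_reindex) ?ord_suml ?ord_sumr.
Qed.

Lemma Lrel_sumC n m (x : LGr n) (y : LGr m) :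
  Lrel (@ord_swap n m) (dsum x y) (dsum y x).
Proof.
move=> _ /dsum_mem[v [u [vy ux ->]]].
have [E1 E2 E3 E4] := symp_sum_coord u v.
exists (symp_sum u v); split; [exact: mem_dsum | exact: supported_bij (ord_swap_bij n m) |].
by apply: symp_sumP => i; rewrite !(lsubmx_reindex, rsubmx_reindex) ?ord_swapl ?ord_swapr.
Qed.

Lemma cast_ord_bij n m (E : n = m) : bijective (cast_ord E).
Proof. exact: Bijective (cast_ordK E) (cast_ordKV E). Qed.

Lemma Lrel_sumA n m p (x : LGr n) (y : LGr m) (z : LGr p) :
  Lrel (cast_ord (addnA n m p)) (dsum (dsum x y) z) (dsum x (dsum y z)).
Proof.
have [E1 E2 E3] := cast_ord_addnA n m p.
move=> _ /dsum_mem[u [_ [ux /dsum_mem[v [w [vy wz ->]]] ->]]].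
have [F1 F2 F3 F4] := symp_sum_coord u v.
have [F1' F2' F3' F4'] := symp_sum_coord v w.
have [G1 G2 G3 G4] := symp_sum_coord (symp_sum u v) w.
exists (symp_sum (symp_sum u v) w).
split; [by do 2?apply: mem_dsum | exact: supported_bij (cast_ord_bij _) |].
apply: symp_sumP => i; try (case: (split_ordP i) => j -> {i});
  rewrite !(lsubmx_reindex, rsubmx_reindex) ?E1 ?E2 ?E3.
all: by rewrite ?G1 ?G2 ?G3 ?G4 ?F1 ?F2 ?F3 ?F4 ?F1' ?F2' ?F3' ?F4'.
Qed.

Lemma Lrel_sum0 n (x : LGr n) : Lrel (@lshift n 0) (dsum x L0) x.
Proof.
move=> u ux; have [E1 E2 E3 E4] := symp_sum_coord u (0 : symp 0).
exists (symp_sum u 0); split; first exact: mem_dsum (mem0v _).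
  by apply: supported_bij; apply: inj_ord_bij (@lshift_inj _ _); rewrite addn0.
by apply: sympP => i; rewrite !(lsubmx_reindex, rsubmx_reindex) ?E1 ?E3.
Qed.

Lemma Lclass_rel n k (h : 'I_k -> 'I_n) (x : LGr n) (y : LGr k) :
  bijective h -> Lrel h x y -> Lclass x = Lclass y.
Proof.
move=> hB; have E := bij_ord_eq hB; subst k => xy.
congr (Tagged _ _); apply/eqmodP; apply/existsP.
(* [sym_act] reindexes along the inverse permutation, so reindexing along [h] is the action of the
   inverse of [s]. *)
pose s := perm (bij_inj hB); exists s^-1%g; rewrite eq_sym eqEdim.
have /andP[_ /eqP dx] := LGrP x; have /andP[_ /eqP dy] := LGrP y.
apply/andP; split; last first.
  rewrite dy; apply: (@leq_trans (\dim x)); last by rewrite dx.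
  by rewrite -(limg_ker_dim (linfun (sym_act s^-1%g)) x) leq_addl.
apply/subvP => _ /xy[v [vx _ ->]]; apply/memv_imgP; exists v => //.
rewrite lfunE /= /sym_act invgK; apply: sympP => i;
  by rewrite !(lsubmx_reindex, rsubmx_reindex) permE.
Qed.

Lemma Lclass_eq n k (x : LGr n) (y : LGr k) : Lclass x = Lclass y ->
  exists2 h : 'I_k -> 'I_n, bijective h & Lrel h x y.
Proof.
move=> E; have nk : n = k := congr1 (@tag _ _) E; subst k.
move/eqP: E; rewrite eq_Tagged => /eqP/eqmodP/existsP[s /eqP sE].
have sB : bijective (s^-1)%g by apply: inj_ord_bij perm_inj.
exists (s^-1)%g => // w; rewrite -sE => /memv_imgP[v vx ->].
by exists v; rewrite lfunE; split=> //; apply: supported_bij.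
Qed.

Lemma Lclass_surj (b : Lorb) : exists n, exists x : LGr n, Lclass x = b.
Proof. by case: b => n q; exists n, (repr q); rewrite /Lclass reprK. Qed.

Definition lagrangian_species : species :=
  Species Lrel_comp Lrel_factor Lrel_restr Lrel_sum Lrel_sumC Lrel_sumA
    Lrel_sum0 Lclass_rel Lclass_eq Lclass_surj.

Lemma lagrangian_species_ops (K : comPzRingType) :
  species_ops (Lalg K : bialg_ops K (sp_cls lagrangian_species)).
Proof.
have reprE n (x : LGr n) : Lclass (repr (tagged (Lclass x))) = Lclass x.
  by rewrite /Lclass reprK.
split=> [n m x y||n x|n x] //.
- rewrite tens_bvec /= linext_bvec; congr bvec.
  by apply: (@sp_cl_sum lagrangian_species); apply: reprE.
- by rewrite /= linext_bvec; apply: (@comul_cl _ lagrangian_species); apply: reprE.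
- by rewrite /= linext_bvec.
Qed.

(** * Lagrangian subspaces of graphs *)

Lemma graphL_mem n (G : sgraph n) x : row_mx x (x *m adj_mx G) \in graphL G.
Proof.
rewrite -[X in row_mx X _]mulmx1 -mul_mx_row mulmx_sum_row.
by apply: rpred_sum => i _; apply: memvZ; apply: memv_span; apply: image_f.
Qed.

Lemma Lrel_graphL n k (h : 'I_k -> 'I_n) (G : sgraph n) (H : sgraph k) :
  injective h -> graph_rel h G H -> Lrel h (graphL G) (graphL H).
Proof.
(* [y] carries the entries of [x] to the indices in the image of [h] and vanishes elsewhere, which
   makes the vector of [graphL G] with e-part [y] supported. *)
move=> hI GH _ /mem_graph_sub[x ->]; pose y := x *m rowsub h 1%:M.
exists (row_mx y (y *m adj_mx G)); split; first exact: graphL_mem.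
  move=> i ih; rewrite row_mxKl mxE big1 // => j _; rewrite !mxE.
  by case: eqP => [E|_]; [rewrite -E codom_f in ih | rewrite mulr0].
apply: sympP => j.
  rewrite lsubmx_reindex !row_mxKl mxE (bigD1 j) //= big1 ?addr0 => [|i ij].
    by rewrite !mxE eqxx mulr1.
  by rewrite !mxE (inj_eq hI) (negPf ij) mulr0.
rewrite rsubmx_reindex !row_mxKr -mulmxA mul_rowsub_mx mul1mx !mxE.
by apply: eq_bigr => i _; rewrite !mxE GH.
Qed.

Lemma graph_rel_of_Lrel n k (h : 'I_k -> 'I_n) (G : sgraph n) (H : sgraph k) :
  injective h -> Lrel h (graphL G) (graphL H) -> graph_rel h G H.
Proof.
move=> hI GH i j; have [_ [/mem_graph_sub[x ->] hx E]] := GH _ (graphL_mem H (delta_mx 0 i)).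
(* On the image of [h] the e-part is that of row [i] for [H]; elsewhere it vanishes by support. The
   f-part is therefore row [h i] of the adjacency matrix of [G]. *)
have xE : x = delta_mx 0 (h i).
  apply/rowP => a; case: (boolP (a \in codom h)) => [/codomP[b ->]|ah].
    have := congr1 (fun w => lsubmx w 0 b) E.
    by rewrite lsubmx_reindex !row_mxKl !mxE (inj_eq hI).
  have := hx _ ah; rewrite row_mxKl !mxE => ->.
  by rewrite eqxx /=; case: eqP ah => // ->; rewrite codom_f.
have := congr1 (fun w => rsubmx w 0 j) E.
rewrite rsubmx_reindex !row_mxKr xE -!rowE !mxE.
by case: (H i j); case: (G (h i) (h j)) => // /eqP; rewrite ?oner_eq0 // eq_sym oner_eq0.
Qed.

(** One inclusion suffices by dimension, and it holds because the adjacency matrix of a disjoint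
    union is block diagonal. *)
Lemma graphL_union n m (G : sgraph n) (H : sgraph m) :
  graphL (gunion G H) = dsum (graphL G) (graphL H).
Proof.
apply: LGr_sub_eq => _ /mem_graph_sub[x ->].
have -> : row_mx x (x *m adj_mx (gunion G H)) =
    symp_sum (row_mx (lsubmx x) (lsubmx x *m adj_mx G))
             (row_mx (rsubmx x) (rsubmx x *m adj_mx H)).
  rewrite symp_sumE !(row_mxKl, row_mxKr) hsubmxK; congr row_mx.
  rewrite /adj_mx /= map_block_mx !map_const_mx -{1}[x]hsubmxK mul_row_block.
  by rewrite !mulmx0 addr0 add0r.
by apply: mem_dsum; apply: graphL_mem.
Qed.

Lemma graphL_empty : graphL gempty = L0.
Proof. by apply: LGr_sub_eq => w _; rewrite [w]thinmx0 mem0v. Qed.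

Lemma graph_embedE (K : comPzRingType) n (G : sgraph n) :
  graph_embed K (bvec (gclass G)) = bvec (Lclass (graphL G)).
Proof.
rewrite /= linext_bvec; congr bvec.
(* The chosen representative is isomorphic to [G], and isomorphic graphs have Lagrangian subspaces
   in the same orbit. *)
have /gclass_eq[h hB GH] : gclass G = gclass (repr (tagged (gclass G))).
  by rewrite /gclass reprK.
by apply/esym/(Lclass_rel hB)/Lrel_graphL => //; apply: bij_inj.
Qed.

Lemma graph_embed_inj (K : comPzRingType) : injective (graph_embed K).
Proof.
apply: linext_bvec_inj => p q /Lclass_eq[h hB /(graph_rel_of_Lrel (bij_inj hB)) GH].
have reprE (b : gtype) : gclass (repr (tagged b)) = b.
  by case: b => n b; rewrite /gclass reprK.
by rewrite -[p]reprE -[q]reprE; apply: gclass_rel hB GH.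
Qed.

Theorem theorem4p5 (K : comPzRingType) :
  ([/\ forall (n m : nat) (L1 : LGr n) (L2 : LGr m),
         bmul (Lalg K) (tens (bvec (Lclass L1)) (bvec (Lclass L2)))
         = bvec (Lclass (dsum L1 L2)),
       forall (n : nat) (L : LGr n),
         bcomul (Lalg K) (bvec (Lclass L))
         = \sum_(I : {set 'I_n})
             tens (bvec (Lclass (restr L I))) (bvec (Lclass (restr L (~: I))))
     & forall (n : nat) (L : LGr n),
         bcounit (Lalg K) (bvec (Lclass L)) = (n == 0%N)%:R]
   /\
   [/\ is_bialgebra (Lalg K),
       is_graded (Lalg K) (fun p => tag p),
       alg_comm (Lalg K)
     & coalg_cocomm (Lalg K)])
  /\
  ([/\ forall (n m : nat) (G1 : sgraph n) (G2 : sgraph m),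
         bmul (Galg K) (tens (bvec (gclass G1)) (bvec (gclass G2)))
         = bvec (gclass (gunion G1 G2)),
       forall (n : nat) (G : sgraph n),
         bcomul (Galg K) (bvec (gclass G))
         = \sum_(J : {set 'I_n})
             tens (bvec (gclass (ginduced G J))) (bvec (gclass (ginduced G (~: J)))),
       forall (n : nat) (G : sgraph n),
         bcounit (Galg K) (bvec (gclass G)) = (n == 0%N)%:R
     & is_bialgebra (Galg K)]
   /\
   [/\ forall (n : nat) (G : sgraph n),
         graph_embed K (bvec (gclass G)) = bvec (Lclass (graphL G)),
       injective (graph_embed K)
     & is_bialgebra_hom (Galg K) (Lalg K) (graph_embed K)]).
Proof.
have HG := graph_species_ops K; have HL := lagrangian_species_ops K.
split; (split; split).
- exact: sp_mulE HL.
- exact: sp_comulE HL.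
- exact: sp_counitE HL.
- exact: species_bialgebra HL.
- exact: species_graded HL _ _.
- exact: sp_alg_comm HL.
- exact: sp_coalg_cocomm HL.
- exact: sp_mulE HG.
- exact: sp_comulE HG.
- exact: sp_counitE HG.
- exact: species_bialgebra HG.
- exact: graph_embedE.
- exact: graph_embed_inj.
- apply: (@species_hom K graph_species lagrangian_species graphL _ _ _ HG HL).
  + exact: Lrel_graphL.
  + by move=> n m G H /=; rewrite graphL_union.
  + by rewrite /= graphL_empty.
  + exact: graph_embedE.
Qed.
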